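(* Let $G$ be a finite group and let $\sigma:\alpha\to\beta$ be a morphism of unitary 2-representations of $G$. Then the map $\chi(\sigma):\chi_\alpha\to\chi_\beta$, with components $\chi(\sigma)_g:\chi_\alpha(g)\to\chi_\beta(g)$, 1. does not depend on the choice of right adjoint $(\sigma^*,\eta,\epsilon)$ for $\sigma$; 2. is indeed a morphism of equivariant vector bundles over $G$; 3. does not depend on the isomorphism class of $\sigma$ (isomorphic 1-morphisms $\sigma\cong\rho$ in $\mathrm{2Rep}(G)$ have $\chi(\sigma)=\chi(\rho)$); 4. is functorial with respect to composition of 1-morphisms in $\mathrm{2Rep}(G)$; and hence $\chi$ descends to a functor $\chi:[\mathrm{2Rep}(G)]\to\mathrm{Hilb}_G(G)$.
   Context: Inner products are linear in the second variable; 2-categories are weak. **2-Hilbert spaces.** An $H^*$-category is a category enriched in finite-dimensional complex Hilbert spaces (with linear maps), with antilinear maps $*:\mathrm{Hom}(x,y)\to\mathrm{Hom}(y,x)$ such that $f^{**}=f$, $(fg)^*=g^*f^*$, $(fg,h)=(g,f^*h)$, $(fg,h)=(f,hg^* )$ whenever defined. A 2-Hilbert space is a Cauchy complete $H^*$-category (equivalently: finite direct sums exist and idempotents split). It is semisimple; finite-dimensional means finitely many isomorphism classes of simple objects $e_i$; $k_i=(\mathrm{id}_{e_i},\mathrm{id}_{e_i})$. A linear $*$-functor is linear on hom-sets with $F(f^* )=F(f)^*$; unitary if unitary on hom-spaces. Unitary morphism: $f^*f=\mathrm{id}$, $ff^*=\mathrm{id}$; unitary natural isomorphism: unitary components. **$\mathrm{2Rep}(G)$.**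 An object $\alpha$ (unitary 2-representation) consists of a finite-dimensional 2-Hilbert space $H_\alpha$, unitary linear $*$-functors $\alpha_g:H_\alpha\to H_\alpha$, unitary natural isomorphisms $a(e):\mathrm{id}\Rightarrow\alpha_e$, $a(g_2,g_1):\alpha_{g_2}\alpha_{g_1}\Rightarrow\alpha_{g_2g_1}$ satisfying the unit and associativity laws of a weak 2-functor. A morphism $\sigma:\alpha\to\beta$ is a linear $*$-functor $H_\alpha\to H_\beta$ with unitary natural isomorphisms $\sigma(g):\beta_g\sigma\Rightarrow\sigma\alpha_g$ such that $\sigma(g_2g_1)\circ(b(g_2,g_1)*\mathrm{id})=(\mathrm{id}*a(g_2,g_1))\circ(\sigma(g_2)*\mathrm{id})\circ(\mathrm{id}*\sigma(g_1))$ and $\sigma(e)\circ(b(e)*\mathrm{id})=\mathrm{id}*a(e)$. A 2-morphism $\theta:\sigma\Rightarrow\rho$ is a natural transformation with $(\theta*\mathrm{id})\circ\sigma(g)=\rho(g)\circ(\mathrm{id}*\theta)$. $[\mathrm{2Rep}(G)]$ has the same objects and isomorphism classes of 1-morphisms. **$\mathrm{Hilb}_G(G)$.** Objects: families of finite-dimensional Hilbert spaces $(V_g)_{g\in G}$ with unitaries $V(h;g):V_g\to V_{hgh^{-1}}$, $V(h_2;h_1gh_1^{-1})V(h_1;g)=V(h_2h_1;g)$, $V(e;g)=\mathrm{id}$ (unitary equivariant vector bundles over $G$). Morphisms: families of linear maps commuting with these. **2-character of an object.** $\chi_\alpha(g)=\mathrm{Nat}(\mathrm{id}_{H_\alpha},\alpha_g)$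 with inner product $\langle\theta,\theta'\rangle=\sum_ik_i(\theta_{e_i},\theta'_{e_i})$ over representative simple objects; $\chi_\alpha(h;g):\chi_\alpha(g)\to\chi_\alpha(hgh^{-1})$ sends $\theta$ to the transformation with components $a(hg,h^{-1})_x\circ a(h,g)_{\alpha_{h^{-1}}x}\circ\alpha_h(\theta_{\alpha_{h^{-1}}x})\circ a(h,h^{-1})_x^*\circ a(e)_x$. **2-character of a morphism.** Choose a right adjoint $(\sigma^*,\eta,\epsilon)$ of the linear $*$-functor $\sigma:H_\alpha\to H_\beta$, with adjunction isomorphisms $\varphi:\mathrm{Hom}(\sigma x,y)\to\mathrm{Hom}(x,\sigma^*y)$. The canonical even-handed structure $\Psi$ on 2-Hilbert spaces makes $\sigma^*$ a left adjoint of $\sigma$ via $\Psi(\varphi):\mathrm{Hom}(\sigma^*y,x)\to\mathrm{Hom}(y,\sigma x)$, $\Psi(\varphi)(h)=(\varphi^\star(h^* ))^*$, with $\varphi^\star$ the Hilbert space adjoint of $\varphi$; its unit is $\Psi(\eta)_y=\Psi(\varphi)(\mathrm{id}_{\sigma^*y}):y\to\sigma\sigma^*y$. Then for $\theta\in\chi_\alpha(g)$, $$\chi(\sigma)_g(\theta)_y=\beta_g(\epsilon_y)\circ\sigma(g)^*_{\sigma^*y}\circ\sigma(\theta_{\sigma^*y})\circ\Psi(\eta)_y .$$ *)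

(* Defs.v *)
From HB Require Import structures.
From mathcomp Require Import all_boot all_order all_algebra all_fingroup.
From mathcomp Require Import complex.
From mathcomp Require Import boolp classical_sets reals.

Set Implicit Arguments.
Unset Strict Implicit.
Unset Printing Implicit Defensive.

Import Order.TTheory GRing.Theory Num.Theory.
Local Open Scope ring_scope.

(* The whole development is parametric in an algebraically closed field [C]
   with conjugation; it is meant for [C := R[i]] with [R : realType]. *)

Record prehilb (C : numClosedFieldType) := PreHilb {
  hcar :> lmodType C;
  ip : hcar -> hcar -> C }.

(* Inner products are linear in the second variable, hence, by Hermitian
   symmetry, antilinear in the first one. *)
Definition is_hilb (C : numClosedFieldType) (V : prehilb C) : Prop :=
  [/\ exists n, exists f : {linear V -> 'rV[C]_n}, bijective f,
      forall u : V, scalar (ip u),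
      forall u v : V, ip v u = (ip u v)^*
    & forall v : V, v != 0 -> 0 < ip v v].

Record hilb (C : numClosedFieldType) := Hilb {
  hpre :> prehilb C;
  hilbP : is_hilb hpre }.

Definition unitary_map (C : numClosedFieldType) (V W : prehilb C)
    (f : V -> W) : Prop :=
  [/\ linear f, forall u v, ip (f u) (f v) = ip u v & bijective f].

(* The Hilbert space adjoint of [f]; meaningful for linear [f], see [hadjP]. *)
Definition hadj (C : numClosedFieldType) (V W : hilb C) (f : V -> W) (w : W)
  : V := xget 0 [set v | forall u, ip (f u) w = ip u v].

Section HilbTheory.
Variable C : numClosedFieldType.

Section OneSpace.
Variable V : hilb C.
Implicit Types (u v w : V) (a : C).

Lemma ip_linr u : scalar (ip u). Proof. by case: (hilbP V). Qed.

Lemma ip_herm u v : ip v u = (ip u v)^*. Proof. by case: (hilbP V). Qed.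

Lemma ip_gt0 v : v != 0 -> 0 < ip v v.
Proof. by case: (hilbP V) => _ _ _; apply. Qed.

Lemma ipDr u v w : ip u (v + w) = ip u v + ip u w.
Proof. by have := ip_linr u 1 v w; rewrite scale1r mul1r. Qed.

Lemma ip0r u : ip u 0 = 0.
Proof. by apply: (addrI (ip u 0)); rewrite -ipDr !addr0. Qed.

Lemma ipZr a u v : ip u (a *: v) = a * ip u v.
Proof. by have := ip_linr u a v 0; rewrite !addr0 ip0r addr0. Qed.

Lemma ipNr u v : ip u (- v) = - ip u v.
Proof. by rewrite -scaleN1r ipZr mulN1r. Qed.

Lemma ipBr u v w : ip u (v - w) = ip u v - ip u w.
Proof. by rewrite ipDr ipNr. Qed.

Lemma ipDl u v w : ip (u + v) w = ip u w + ip v w.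
Proof. by rewrite ip_herm ipDr rmorphD /= -!ip_herm. Qed.

Lemma ip0l u : ip 0 u = 0.
Proof. by rewrite ip_herm ip0r conjC0. Qed.

Lemma ipZl a u v : ip (a *: u) v = a^* * ip u v.
Proof. by rewrite ip_herm ipZr rmorphM /= -ip_herm. Qed.

Lemma ip_suml (I : Type) (r : seq I) (P : pred I) (F : I -> V) u :
  ip (\sum_(i <- r | P i) F i) u = \sum_(i <- r | P i) ip (F i) u.
Proof.
by elim/big_rec2: _ => [|i y1 y2 _ <-]; rewrite ?ip0l ?ipDl.
Qed.

Lemma ip_sumr (I : Type) (r : seq I) (P : pred I) (F : I -> V) u :
  ip u (\sum_(i <- r | P i) F i) = \sum_(i <- r | P i) ip u (F i).
Proof.
by elim/big_rec2: _ => [|i y1 y2 _ <-]; rewrite ?ip0r ?ipDr.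
Qed.

Lemma ip_eq0 v : ip v v = 0 -> v = 0.
Proof.
by move=> vv0; case: (eqVneq v 0) => // /ip_gt0; rewrite vv0 ltxx.
Qed.

Lemma ip_inj u v : (forall w, ip w u = ip w v) -> u = v.
Proof.
move=> uv; apply/eqP; rewrite -subr_eq0; apply/eqP/ip_eq0.
by rewrite ipBr uv subrr.
Qed.

Lemma riesz (L : V -> C) : scalar L -> exists v, forall u, L u = ip v u.
Proof.
move=> Llin; case: (hilbP V) => -[n [f [g fK gK]]] _ _ _.
have LD u v : L (u + v) = L u + L v.
  by have := Llin 1 u v; rewrite scale1r mul1r.
have L0 : L 0 = 0 by apply: (addrI (L 0)); rewrite -LD !addr0.
have LZ a u : L (a *: u) = a * L u.
  by have := Llin a u 0; rewrite !addr0 L0 addr0.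
have Lsum (F : 'I_n -> V) : L (\sum_i F i) = \sum_i L (F i).
  by elim/big_rec2: _ => [//|i y1 y2 _ <-]; rewrite LD.
pose e i : V := g (delta_mx 0 i).
have decomp u : u = \sum_i (f u 0 i) *: e i.
  apply: (can_inj fK); rewrite linear_sum [LHS]row_sum_delta.
  by apply: eq_bigr => i _; rewrite linearZ /= gK.
pose M : 'M[C]_n := \matrix_(j, i) ip (e j) (e i).
have Minj (d : 'rV_n) : d *m M = 0 -> d = 0.
  move=> dM; pose v := \sum_j (d 0 j)^* *: e j.
  have ve i : ip v (e i) = 0.
    rewrite /v ip_suml; have := congr1 (fun A : 'rV_n => A 0 i) dM.
    rewrite !mxE => dMi; rewrite -[RHS]dMi; apply: eq_bigr => j _.
    by rewrite ipZl conjCK mxE.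
  have v0 : v = 0.
    apply: ip_eq0; rewrite {2}(decomp v) ip_sumr big1 // => i _.
    by rewrite ipZr ve mulr0.
  have fv : f v = \row_j (d 0 j)^*.
    rewrite /v linear_sum [RHS]row_sum_delta; apply: eq_bigr => j _.
    by rewrite linearZ /= gK mxE.
  apply/rowP => j; have := congr1 (fun A : 'rV_n => A 0 j) fv.
  rewrite v0 linear0 !mxE => /esym/eqP; rewrite conjC_eq0 => /eqP -> //.
have Mfree : row_free M.
  rewrite -kermx_eq0; apply/eqP/row_matrixP => i; rewrite row0.
  by apply: Minj; rewrite -row_mul mulmx_ker row0.
have Munit : M \in unitmx by rewrite -row_free_unit.
pose d : 'rV_n := (\row_i L (e i)) *m invmx M.
exists (\sum_j (d 0 j)^* *: e j) => u.
rewrite [in LHS](decomp u) [in RHS](decomp u) Lsum ip_sumr.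
apply: eq_bigr => i _; rewrite LZ ipZr; congr (_ * _).
have : (d *m M) 0 i = L (e i) by rewrite /d mulmxKV // mxE.
move=> <-; rewrite mxE ip_suml; apply: eq_bigr => j _.
by rewrite ipZl conjCK [M _ _]mxE.
Qed.

End OneSpace.

Lemma hadjP (V W : hilb C) (f : V -> W) : linear f ->
  forall u w, ip (f u) w = ip u (hadj f w).
Proof.
move=> flin u w; rewrite /hadj; case: xgetP => [v _ /= -> //|noadj].
have /riesz[v vP] : scalar (fun u => ip w (f u)).
  by move=> a x y; rewrite flin ip_linr.
by case: (noadj v) => x /=; rewrite ip_herm vP -ip_herm.
Qed.

End HilbTheory.

Reserved Notation "g \c f" (at level 40, left associativity).

Record hstarCat (C : numClosedFieldType) := HStarCat {
  hobj :> Type;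
  hom : hobj -> hobj -> hilb C;
  idm : forall x, hom x x;
  comp : forall x y z, hom y z -> hom x y -> hom x z
    where "g \c f" := (comp g f);
  star : forall x y, hom x y -> hom y x;
  compA : forall w x y z (h : hom y z) (g : hom x y) (f : hom w x),
    h \c (g \c f) = (h \c g) \c f;
  comp1m : forall x y (f : hom x y), idm y \c f = f;
  compm1 : forall x y (f : hom x y), f \c idm x = f;
  comp_linl : forall x y z (f : hom x y),
    linear (fun g : hom y z => g \c f);
  comp_linr : forall x y z (g : hom y z),
    linear (fun f : hom x y => g \c f);
  star_anti : forall x y (a : C) (f g : hom x y),
    star (a *: f + g) = a^* *: star f + star g;
  starK : forall x y (f : hom x y), star (star f) = f;
  starM : forall x y z (f : hom y z) (g : hom x y),
    star (f \c g) = star g \c star f;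
  ip_compl : forall x y z (f : hom y z) (g : hom x y) (h : hom x z),
    ip (f \c g) h = ip g (star f \c h);
  ip_compr : forall x y z (f : hom y z) (g : hom x y) (h : hom x z),
    ip (f \c g) h = ip f (h \c star g) }.


Arguments idm {C} {_} x.
Notation "g \c f" := (comp g f).

Section Cats.
Variable C : numClosedFieldType.

Section OneCat.
Variable H : hstarCat C.
Implicit Types x y z : H.

Definition iso_mor x y (f : hom x y) : Prop :=
  exists g : hom y x, g \c f = idm x /\ f \c g = idm y.

Definition iso_obj x y : Prop := exists f : hom x y, iso_mor f.

Definition unitary_mor x y (f : hom x y) : Prop :=
  star f \c f = idm x /\ f \c star f = idm y.

Definition mono_mor x y (f : hom x y) : Prop :=
  forall w (u v : hom w x), f \c u = f \c v -> u = v.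

(* Non-zero, with no subobjects other than zero and the object itself. *)
Definition simple_obj x : Prop :=
  idm x <> 0 /\
  forall s (m : hom s x), mono_mor m -> m = 0 \/ iso_mor m.

Definition has_zero_obj : Prop := exists z : H, idm z = 0.

Definition has_direct_sums : Prop :=
  forall x y, exists (z : H) (i1 : hom x z) (i2 : hom y z)
                     (p1 : hom z x) (p2 : hom z y),
  [/\ p1 \c i1 = idm x, p2 \c i2 = idm y, p2 \c i1 = 0, p1 \c i2 = 0
    & i1 \c p1 + i2 \c p2 = idm z].

Definition idempotents_split : Prop :=
  forall x (p : hom x x), p \c p = p ->
  exists (y : H) (r : hom x y) (s : hom y x),
    s \c r = p /\ r \c s = idm y.

(* [e] lists every isomorphism class of simple objects exactly once. *)
Definition simple_reps n (e : 'I_n -> H) : Prop :=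
  [/\ forall i, simple_obj (e i),
      forall i j, iso_obj (e i) (e j) -> i = j
    & forall x, simple_obj x -> exists i, iso_obj x (e i)].

Definition fin_dim : Prop := exists n (e : 'I_n -> H), simple_reps e.

End OneCat.

Record twoHilb := TwoHilb {
  tcat :> hstarCat C;
  tzero : has_zero_obj tcat;
  tsums : has_direct_sums tcat;
  tsplit : idempotents_split tcat }.

Record fdTwoHilb := FdTwoHilb {
  fdcat :> twoHilb;
  fdP : fin_dim fdcat }.

Definition nsimple (H : fdTwoHilb) : nat := projT1 (cid (fdP H)).
Definition simples (H : fdTwoHilb) : 'I_(nsimple H) -> H :=
  projT1 (cid (projT2 (cid (fdP H)))).

Lemma simplesP (H : fdTwoHilb) : simple_reps (@simples H).
Proof. exact: (projT2 (cid (projT2 (cid (fdP H))))). Qed.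

Section HomTheory.
Variable H : hstarCat C.
Implicit Types x y z : H.

Lemma compDl x y z (f g : hom y z) (h : hom x y) :
  (f + g) \c h = f \c h + g \c h.
Proof. by have := comp_linl h 1 f g; rewrite !scale1r. Qed.

Lemma compDr x y z (f g : hom x y) (h : hom y z) :
  h \c (f + g) = h \c f + h \c g.
Proof. by have := comp_linr h 1 f g; rewrite !scale1r. Qed.

Lemma comp0l x y z (h : hom x y) : (0 : hom y z) \c h = 0.
Proof. by apply: (addrI (0 \c h)); rewrite -compDl !addr0. Qed.

Lemma comp0r x y z (h : hom y z) : h \c (0 : hom x y) = 0.
Proof. by apply: (addrI (h \c 0)); rewrite -compDr !addr0. Qed.

Lemma compZl x y z a (f : hom y z) (h : hom x y) :
  (a *: f) \c h = a *: (f \c h).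
Proof. by have := comp_linl h a f 0; rewrite comp0l !addr0. Qed.

Lemma compZr x y z a (f : hom x y) (h : hom y z) :
  h \c (a *: f) = a *: (h \c f).
Proof. by have := comp_linr h a f 0; rewrite comp0r !addr0. Qed.

Lemma compNl x y z (f : hom y z) (h : hom x y) : (- f) \c h = - (f \c h).
Proof. by rewrite -scaleN1r compZl scaleN1r. Qed.

Lemma compNr x y z (f : hom x y) (h : hom y z) : h \c (- f) = - (h \c f).
Proof. by rewrite -scaleN1r compZr scaleN1r. Qed.

Lemma star1 x : star (idm x) = idm x.
Proof. by rewrite -[LHS]comp1m -{1}(starK (idm x)) -starM comp1m starK. Qed.

End HomTheory.

Record functor (H K : hstarCat C) := Functor {
  fobj :> H -> K;
  fmap : forall x y : H, hom x y -> hom (fobj x) (fobj y);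
  fmap1 : forall x, fmap (idm x) = idm (fobj x);
  fmapM : forall x y z (g : hom y z) (f : hom x y),
    fmap (g \c f) = fmap g \c fmap f }.

Definition is_lin_star (H K : hstarCat C) (F : functor H K) : Prop :=
  (forall x y, linear (@fmap H K F x y)) /\
  (forall x y (f : hom x y), fmap F (star f) = star (fmap F f)).

Record lsfunctor (H K : hstarCat C) := LSFunctor {
  lsf :> functor H K;
  lsfP : is_lin_star lsf }.

Definition unitary_functor (H K : hstarCat C) (F : functor H K) : Prop :=
  forall x y, unitary_map (@fmap H K F x y).

Definition idF0 (H : hstarCat C) : functor H H :=
  @Functor H H id (fun x y f => f) (fun x => erefl) (fun x y z g f => erefl).

Lemma idF_ls H : is_lin_star (idF0 H). Proof. by split. Qed.

Definition idF H : lsfunctor H H := LSFunctor (idF_ls H).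

Section Compose.
Variables H K L : hstarCat C.

Section Plain.
Variables (F : functor K L) (E : functor H K).

Lemma compF_1 x : fmap F (fmap E (idm x)) = idm (F (E x)).
Proof. by rewrite !fmap1. Qed.

Lemma compF_M x y z (g : hom y z) (f : hom x y) :
  fmap F (fmap E (g \c f)) = fmap F (fmap E g) \c fmap F (fmap E f).
Proof. by rewrite !fmapM. Qed.

Definition compF0 : functor H L :=
  @Functor H L (fun x => F (E x)) (fun x y f => fmap F (fmap E f))
    compF_1 compF_M.
End Plain.

Lemma compF_ls (F : lsfunctor K L) (E : lsfunctor H K) :
  is_lin_star (compF0 F E).
Proof.
case: (lsfP F) (lsfP E) => Fl Fs [El Es]; split=> [x y a f g|x y f] /=.
  by rewrite El Fl.
by rewrite Es Fs.
Qed.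

Definition compF (F : lsfunctor K L) (E : lsfunctor H K) : lsfunctor H L :=
  LSFunctor (compF_ls F E).

End Compose.

Definition natural (H K : hstarCat C) (F G : functor H K)
    (t : forall x, hom (F x) (G x)) : Prop :=
  forall x y (f : hom x y), t y \c fmap F f = fmap G f \c t x.

Record nat_trans (H K : hstarCat C) (F G : functor H K) := NatTrans {
  ncomp :> forall x, hom (F x) (G x);
  ncompP : natural ncomp }.

Lemma nat_trans_ext (H K : hstarCat C) (F G : functor H K)
  (s t : nat_trans F G) : (forall x, s x = t x) -> s = t.
Proof.
case: s t => [s sP] [t tP] /= st.
have {}st : s = t by apply: functional_extensionality_dep.
by case: _ / st in tP *; rewrite (Prop_irrelevance sP tP).
Qed.

Section NatSpace.
Variables (H K : hstarCat C) (F G : functor H K).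
Local Notation N := (nat_trans F G).

HB.instance Definition _ := gen_eqMixin N.
HB.instance Definition _ := gen_choiceMixin N.

Lemma nat0P : natural (fun x => 0 : hom (F x) (G x)).
Proof. by move=> x y f; rewrite comp0l comp0r. Qed.

Lemma natNP (s : N) : natural (fun x => - s x).
Proof. by move=> x y f; rewrite compNl compNr ncompP. Qed.

Lemma natDP (s t : N) : natural (fun x => s x + t x).
Proof. by move=> x y f; rewrite compDl compDr !ncompP. Qed.

Lemma natZP a (s : N) : natural (fun x => a *: s x).
Proof. by move=> x y f; rewrite compZl compZr ncompP. Qed.

Definition nat0 : N := NatTrans nat0P.
Definition natN (s : N) : N := NatTrans (natNP s).
Definition natD (s t : N) : N := NatTrans (natDP s t).
Definition natZ a (s : N) : N := NatTrans (natZP a s).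

Lemma natDA : associative natD.
Proof. by move=> s t u; apply: nat_trans_ext => x; apply: addrA. Qed.
Lemma natDC : commutative natD.
Proof. by move=> s t; apply: nat_trans_ext => x; apply: addrC. Qed.
Lemma nat0D : left_id nat0 natD.
Proof. by move=> s; apply: nat_trans_ext => x; apply: add0r. Qed.
Lemma natND : left_inverse nat0 natN natD.
Proof. by move=> s; apply: nat_trans_ext => x; apply: addNr. Qed.

HB.instance Definition _ :=
  GRing.isZmodule.Build N natDA natDC nat0D natND.

Lemma natZA a b (s : N) : natZ a (natZ b s) = natZ (a * b) s.
Proof. by apply: nat_trans_ext => x; apply: scalerA. Qed.
Lemma natZ1 : left_id 1 natZ.
Proof. by move=> s; apply: nat_trans_ext => x; apply: scale1r. Qed.
Lemma natZDr : right_distributive natZ +%R.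
Proof. by move=> a s t; apply: nat_trans_ext => x; apply: scalerDr. Qed.
Lemma natZDl (s : N) : {morph natZ^~ s : a b / a + b}.
Proof. by move=> a b; apply: nat_trans_ext => x; apply: scalerDl. Qed.

HB.instance Definition _ :=
  GRing.Zmodule_isLmodule.Build C N natZA natZ1 natZDr natZDl.

Lemma natDE (s t : N) x : (s + t) x = s x + t x. Proof. by []. Qed.
Lemma natZE a (s : N) x : (a *: s) x = a *: s x. Proof. by []. Qed.

End NatSpace.

Definition unitary_nat (H K : hstarCat C) (F G : functor H K)
    (t : nat_trans F G) : Prop := forall x, unitary_mor (t x).

(* [radj] is an arbitrary functor: neither linearity nor compatibility with
   [star] is required (the former is automatic, the latter is not). *)
Record right_adjoint (H K : hstarCat C) (F : functor H K) := RightAdjoint {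
  radj : functor K H;
  runit : nat_trans (idF H) (compF0 radj F);
  rcounit : nat_trans (compF0 F radj) (idF K);
  rtri1 : forall x, rcounit (F x) \c fmap F (runit x) = idm (F x);
  rtri2 : forall y,
    fmap radj (rcounit y) \c runit (radj y) = idm (radj y) }.

Section EvenHanded.
Variables (H K : hstarCat C) (F : functor H K) (A : right_adjoint F).

Definition adj_phi (x : H) (y : K) (f : hom (F x) y) : hom x (radj A y) :=
  fmap (radj A) f \c runit A x.

(* Exhibits [radj A] as a left adjoint of [F], with unit [psi_unit]. *)
Definition adj_psi (x : H) (y : K) (h : hom (radj A y) x) : hom y (F x) :=
  star (hadj (@adj_phi x y) (star h)).

Definition psi_unit (y : K) : hom y (F (radj A y)) :=
  adj_psi (idm (radj A y)).

End EvenHanded.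

Section EvenHandedTheory.
Variables (H K : hstarCat C) (F : lsfunctor H K) (A : right_adjoint F).

Lemma adj_phiK x y (h : hom x (radj A y)) :
  adj_phi A (rcounit A y \c fmap F h : hom (F x) y) = h.
Proof.
rewrite /adj_phi fmapM -compA; have /= <- := ncompP (runit A) h.
by rewrite compA rtri2 comp1m.
Qed.

Lemma adj_phiVK x y (f : hom (F x) y) :
  rcounit A y \c fmap F (adj_phi A f) = f.
Proof.
rewrite /adj_phi fmapM compA; have /= -> := ncompP (rcounit A) f.
by rewrite -compA rtri1 compm1.
Qed.

Lemma adj_phi_linear x y : linear (@adj_phi H K F A x y).
Proof.
move=> a f g; rewrite -[RHS]adj_phiK; congr (adj_phi A _).
case: (lsfP F) => Fl _.
by rewrite Fl compDr compZr !adj_phiVK.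
Qed.

Lemma adj_psiP x y (h : hom (radj A y) x) (f : hom (F x) y) :
  ip (adj_phi A f) (star h) = ip f (star (adj_psi h)).
Proof. by rewrite /adj_psi starK (hadjP (@adj_phi_linear x y)). Qed.

Lemma adj_psi_natl x x' y (h : hom (radj A y) x) (u : hom x x') :
  adj_psi (u \c h) = fmap F u \c adj_psi h.
Proof.
apply: (can_inj (@starK _ _ _ _)); apply: ip_inj => f.
rewrite -adj_psiP !starM -!ip_compr -adj_psiP; congr (ip _ _).
by rewrite /adj_phi fmapM -!compA; have /= <- := ncompP (runit A) u.
Qed.

Lemma adj_psi_natr x y y' (h : hom (radj A y') x) (v : hom y y') :
  adj_psi (h \c fmap (radj A) v) = adj_psi h \c v.
Proof.
apply: (can_inj (@starK _ _ _ _)); apply: ip_inj => f.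
rewrite -adj_psiP !starM -!ip_compl -adj_psiP; congr (ip _ _).
by rewrite /adj_phi fmapM compA.
Qed.

Lemma psi_unit_natural : @natural K K (idF K) (compF0 F (radj A)) (psi_unit A).
Proof.
move=> y y' v /=; rewrite /psi_unit -adj_psi_natr -adj_psi_natl.
by rewrite comp1m compm1.
Qed.

End EvenHandedTheory.

Section TwoRep.
Variable gT : finGroupType.
Local Open Scope group_scope.

(* [F g] and [F g'] are equal functors when [g = g']; this is the identity
   morphism between their values at [x]. *)
Definition gcast (H : hstarCat C) (F : gT -> functor H H) (g g' : gT)
    (e : g = g') (x : H) : hom (F g x) (F g' x) :=
  match e in _ = k return hom (F g x) (F k x) with erefl => idm (F g x) end.

Record rep2 := Rep2 {
  rcat :> fdTwoHilb;
  act : gT -> lsfunctor rcat rcat;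
  act_unitary : forall g, unitary_functor (act g);
  aunit : nat_trans (idF rcat) (act 1);
  amul : forall g2 g1, nat_trans (compF (act g2) (act g1)) (act (g2 * g1));
  aunit_unitary : unitary_nat aunit;
  amul_unitary : forall g2 g1, unitary_nat (amul g2 g1);
  amul1g : forall g x,
    gcast act (mul1g g) x \c amul 1 g x \c aunit (act g x) = idm (act g x);
  amulg1 : forall g x,
    gcast act (mulg1 g) x \c amul g 1 x \c fmap (act g) (aunit x)
      = idm (act g x);
  amulA : forall g3 g2 g1 x,
    gcast act (mulgA g3 g2 g1) x
      \c amul g3 (g2 * g1) x \c fmap (act g3) (amul g2 g1 x)
    = amul (g3 * g2) g1 x \c amul g3 g2 (act g1 x) }.

Record mor1 (a b : rep2) := Mor1 {
  mfun :> lsfunctor a b;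
  mnat : forall g, nat_trans (compF (act b g) mfun) (compF mfun (act a g));
  mnat_unitary : forall g, unitary_nat (mnat g);
  mnatM : forall g2 g1 x,
    mnat (g2 * g1) x \c amul b g2 g1 (mfun x)
    = fmap mfun (amul a g2 g1 x)
        \c mnat g2 (act a g1 x) \c fmap (act b g2) (mnat g1 x);
  mnat1 : forall x,
    mnat 1 x \c aunit b (mfun x) = fmap mfun (aunit a x) }.

(* Naturality is part of [nat_trans]. *)
Definition is_mor2 (a b : rep2) (s r : mor1 a b) (t : nat_trans s r) : Prop :=
  forall g x, t (act a g x) \c mnat s g x = mnat r g x \c fmap (act b g) (t x).

(* Isomorphism of 1-morphisms in 2Rep(G); the invertible 2-morphism need not
   be unitary. *)
Definition iso1 (a b : rep2) (s r : mor1 a b) : Prop :=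
  exists (t : nat_trans s r) (t' : nat_trans r s),
  [/\ is_mor2 t, is_mor2 t', forall x, t' x \c t x = idm (s x)
    & forall x, t x \c t' x = idm (r x)].

Section Identity.
Variable a : rep2.

Lemma id1_natP g : natural (F := compF (act a g) (idF a))
  (G := compF (idF a) (act a g)) (fun x => idm (act a g x)).
Proof. by move=> x y f /=; rewrite comp1m compm1. Qed.

Definition id1_nat g := NatTrans (id1_natP g).

Lemma id1_unitary g : unitary_nat (id1_nat g).
Proof. by move=> x; split; rewrite /= star1 comp1m. Qed.

Lemma id1_M g2 g1 x :
  id1_nat (g2 * g1) x \c amul a g2 g1 x
  = amul a g2 g1 x \c id1_nat g2 (act a g1 x)
      \c fmap (act a g2) (id1_nat g1 x).
Proof. by rewrite /= fmap1 !compm1 comp1m. Qed.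

Lemma id1_1 x : id1_nat 1 x \c aunit a x = aunit a x.
Proof. by rewrite /= comp1m. Qed.

Definition id1 : mor1 a a := @Mor1 a a (idF a) id1_nat id1_unitary id1_M id1_1.
End Identity.

Section Composition.
Variables (a b c : rep2) (t : mor1 b c) (s : mor1 a b).

Definition comp1_fun g (x : a) : hom (act c g (t (s x))) (t (s (act a g x))) :=
  fmap t (mnat s g x) \c mnat t g (s x).

Lemma comp1_natP g :
  natural (F := compF (act c g) (compF t s)) (G := compF (compF t s) (act a g))
    (comp1_fun g).
Proof.
move=> x y f; rewrite /comp1_fun /=.
have /= tn := ncompP (mnat t g) (fmap s f).
have /= sn := ncompP (mnat s g) f.
by rewrite -compA tn !compA -!fmapM sn.
Qed.

Definition comp1_nat g := NatTrans (comp1_natP g).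

Lemma unitary_comp (H : hstarCat C) (x y z : H) (f : hom y z) (g : hom x y) :
  unitary_mor f -> unitary_mor g -> unitary_mor (f \c g).
Proof.
move=> [f1 f2] [g1 g2]; split; rewrite starM.
  by rewrite -compA [star f \c _]compA f1 comp1m.
by rewrite -compA [g \c _]compA g2 comp1m.
Qed.

Lemma unitary_fmap (H K : hstarCat C) (F : lsfunctor H K) (x y : H)
  (f : hom x y) : unitary_mor f -> unitary_mor (fmap F f).
Proof.
case: (lsfP F) => _ Fs [f1 f2].
by split; rewrite -Fs -fmapM ?f1 ?f2 fmap1.
Qed.

Lemma comp1_unitary g : unitary_nat (comp1_nat g).
Proof.
move=> x; apply: unitary_comp; last exact: mnat_unitary.
exact/unitary_fmap/mnat_unitary.
Qed.

Lemma comp1_M g2 g1 x :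
  comp1_nat (g2 * g1) x \c amul c g2 g1 (t (s x))
  = fmap t (fmap s (amul a g2 g1 x)) \c comp1_nat g2 (act a g1 x)
      \c fmap (act c g2) (comp1_nat g1 x).
Proof.
rewrite /= /comp1_fun -[LHS]compA; have /= -> := mnatM t g2 g1 (s x).
rewrite !compA -!fmapM; have /= -> := mnatM s g2 g1 x.
rewrite !fmapM -!compA; do 2 congr (_ \c _); rewrite !compA; congr (_ \c _).
by have /= -> := ncompP (mnat t g2) (mnat s g1 x).
Qed.

Lemma comp1_1 x :
  comp1_nat 1 x \c aunit c (t (s x)) = fmap t (fmap s (aunit a x)).
Proof. 
rewrite /= /comp1_fun -[LHS]compA; have /= -> := mnat1 t (s x).
by rewrite -fmapM; have /= -> := mnat1 s x.
Qed.

Definition comp1 : mor1 a c :=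
  @Mor1 a c (compF t s) comp1_nat comp1_unitary comp1_M comp1_1.
End Composition.

(* Equivariant vector bundles over [gT], first without their axioms. *)
Record prebundle := PreBundle {
  fib :> gT -> prehilb C;
  bact : forall h g, fib g -> fib (h * g * h^-1) }.

Lemma conj_conj (h2 h1 g : gT) :
  h2 * (h1 * g * h1^-1) * h2^-1 = (h2 * h1) * g * (h2 * h1)^-1.
Proof. by rewrite invMg !mulgA. Qed.

Lemma conj_1 (g : gT) : 1 * g * 1^-1 = g.
Proof. by rewrite mul1g invg1 mulg1. Qed.

Definition is_bundle (V : prebundle) : Prop :=
  [/\ forall g, is_hilb (V g),
      forall h g, unitary_map (@bact V h g),
      forall h2 h1 g (v : V g),
        ecast k (V k) (conj_conj h2 h1 g) (bact h2 (bact h1 v))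
        = bact (h2 * h1) v
    & forall g (v : V g), ecast k (V k) (conj_1 g) (bact 1 v) = v].

Record bundle := Bundle {
  pbundle :> prebundle;
  bundleP : is_bundle pbundle }.

Definition is_bundle_map (V W : prebundle) (f : forall g, V g -> W g) : Prop :=
  (forall g, linear (f g)) /\
  (forall h g (v : V g), f (h * g * h^-1) (bact h v) = bact h (f g v)).

Section TwoCharObj.
Variable a : rep2.

(* The weights are k_i = (id, id) on the i-th representative simple object. *)
Definition chi_ip g (t t' : nat_trans (idF a) (act a g)) : C :=
  \sum_i ip (idm (simples i)) (idm (simples i))
           * ip (t (@simples a i)) (t' (simples i)).

Definition chi_fib g : prehilb C :=
  @PreHilb C (nat_trans (idF a) (act a g)) (@chi_ip g).

Definition chi_act_fun h g (t : nat_trans (idF a) (act a g)) (x : a)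
  : hom x (act a (h * g * h^-1) x) :=
  amul a (h * g) h^-1 x
    \c amul a h g (act a h^-1 x)
    \c fmap (act a h) (t (act a h^-1 x))
    \c star (amul a h h^-1 x)
    \c gcast (act a) (esym (mulgV h)) x
    \c aunit a x.

Lemma gcast_natural (H : hstarCat C) (F : gT -> functor H H) (g g' : gT)
  (e : g = g') : natural (gcast F e).
Proof. by case: _ / e => x y f /=; rewrite comp1m compm1. Qed.

Lemma star_natural (H K : hstarCat C) (F G : lsfunctor H K)
  (t : nat_trans F G) : @natural H K G F (fun x => star (t x)).
Proof.
move=> x y f; apply: (can_inj (@starK _ _ _ _)).
case: (lsfP F) (lsfP G) => [_ Fs] [_ Gs].
by rewrite !starM !starK -Fs -Gs ncompP.
Qed.

Lemma chi_actP h g (t : nat_trans (idF a) (act a g)) :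
  @natural a a (idF a) (act a (h * g * h^-1)) (chi_act_fun h t).
Proof.
move=> x y f; rewrite /chi_act_fun /=.
rewrite -!compA; have /= -> := ncompP (aunit a) f.
rewrite !compA; congr (_ \c _).
rewrite -!compA; have /= -> := gcast_natural (act a) (esym (mulgV h)) f.
rewrite !compA; congr (_ \c _).
rewrite -!compA; have /= -> := star_natural (amul a h h^-1) f.
rewrite !compA; congr (_ \c _).
rewrite -!compA -fmapM; have /= -> := ncompP t (fmap (act a h^-1) f).
rewrite fmapM !compA; congr (_ \c _).
rewrite -!compA; have /= -> := ncompP (amul a h g) (fmap (act a h^-1) f).
rewrite !compA; congr (_ \c _).
by have /= -> := ncompP (amul a (h * g) h^-1) f.
Qed.

Definition chi_act h g (t : chi_fib g) : chi_fib (h * g * h^-1) :=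
  NatTrans (chi_actP h t).

Definition chi_obj : prebundle := @PreBundle chi_fib chi_act.

End TwoCharObj.

Section TwoCharMor.
Variables (a b : rep2) (s : mor1 a b) (A : right_adjoint s).

Definition chi_mor_fun g (t : nat_trans (idF a) (act a g)) (y : b)
  : hom y (act b g y) :=
  fmap (act b g) (rcounit A y)
    \c star (mnat s g (radj A y))
    \c fmap s (t (radj A y))
    \c psi_unit A y.

Lemma chi_morP g (t : nat_trans (idF a) (act a g)) :
  @natural b b (idF b) (act b g) (chi_mor_fun t).
Proof.
move=> x y f; rewrite /chi_mor_fun /=.
rewrite -!compA; have /= -> := psi_unit_natural A f.
rewrite !compA; congr (_ \c _).
rewrite -!compA -fmapM; have /= -> := ncompP t (fmap (radj A) f).
rewrite fmapM !compA; congr (_ \c _).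
rewrite -!compA; have /= -> := star_natural (mnat s g) (fmap (radj A) f).
rewrite !compA; congr (_ \c _).
by rewrite -!fmapM; have /= -> := ncompP (rcounit A) f.
Qed.

Definition chi_mor g (t : chi_obj a g) : chi_obj b g :=
  NatTrans (chi_morP t).

End TwoCharMor.

Section Iso1.

Lemma iso1_refl (a b : rep2) (s : mor1 a b) : iso1 s s.
Proof.
have P : natural (fun x => idm (s x)).
  by move=> x y f; rewrite comp1m compm1.
have Q : is_mor2 (s := s) (r := s) (NatTrans P).
  by move=> g x; rewrite /= fmap1 comp1m compm1.
by exists (NatTrans P), (NatTrans P); split=> // x; rewrite /= comp1m.
Qed.

Lemma iso1_sym (a b : rep2) (s r : mor1 a b) : iso1 s r -> iso1 r s.
Proof. by case=> t [t' [Ht Ht' H1 H2]]; exists t', t. Qed.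

Lemma iso1_trans (a b : rep2) (s r q : mor1 a b) :
  iso1 s r -> iso1 r q -> iso1 s q.
Proof.
case=> t [t' [Ht Ht' H1 H2]] [u [u' [Hu Hu' K1 K2]]].
have P : natural (F := s) (G := q) (fun x => u x \c t x).
  by move=> x y f; rewrite -compA ncompP !compA ncompP.
have P' : natural (F := q) (G := s) (fun x => t' x \c u' x).
  by move=> x y f; rewrite -compA ncompP !compA ncompP.
exists (NatTrans P), (NatTrans P'); split=> [g x|g x|x|x] /=.
- by rewrite fmapM -compA Ht !compA Hu.
- by rewrite fmapM -compA Hu' !compA Ht'.
- by rewrite -compA [u' x \c _]compA K1 comp1m.
- by rewrite -compA [t x \c _]compA H2 comp1m.
Qed.

Lemma is_mor2_whiskl (a b c : rep2) (t : mor1 b c) (s s' : mor1 a b)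
    (u : nat_trans s s') (P : natural (F := comp1 t s) (G := comp1 t s')
      (fun x => fmap t (u x))) :
  is_mor2 u -> is_mor2 (s := comp1 t s) (r := comp1 t s') (NatTrans P).
Proof.
move=> Hu g x; rewrite /= /comp1_fun [LHS]compA -fmapM Hu fmapM -[LHS]compA.
by have /= <- := ncompP (mnat t g) (u x); rewrite compA.
Qed.

Lemma iso1_whiskl (a b c : rep2) (t : mor1 b c) (s s' : mor1 a b) :
  iso1 s s' -> iso1 (comp1 t s) (comp1 t s').
Proof.
case=> u [u' [Hu Hu' H1 H2]].
have P : natural (F := comp1 t s) (G := comp1 t s') (fun x => fmap t (u x)).
  by move=> x y f; rewrite /= -!fmapM ncompP.
have P' : natural (F := comp1 t s') (G := comp1 t s) (fun x => fmap t (u' x)).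
  by move=> x y f; rewrite /= -!fmapM ncompP.
exists (NatTrans P), (NatTrans P').
split=> [||x|x]; [exact: is_mor2_whiskl|exact: is_mor2_whiskl| |].
- by rewrite /= -fmapM H1 fmap1.
- by rewrite /= -fmapM H2 fmap1.
Qed.

Lemma is_mor2_whiskr (a b c : rep2) (t t' : mor1 b c) (s : mor1 a b)
    (u : nat_trans t t') (P : natural (F := comp1 t s) (G := comp1 t' s)
      (fun x => u (s x))) :
  is_mor2 u -> is_mor2 (s := comp1 t s) (r := comp1 t' s) (NatTrans P).
Proof.
move=> Hu g x; rewrite /= /comp1_fun [LHS]compA.
have /= -> := ncompP u (mnat s g x).
by rewrite -[LHS]compA; have /= -> := Hu g (s x); rewrite compA.
Qed.

Lemma iso1_whiskr (a b c : rep2) (t t' : mor1 b c) (s : mor1 a b) :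
  iso1 t t' -> iso1 (comp1 t s) (comp1 t' s).
Proof.
case=> u [u' [Hu Hu' H1 H2]].
have P : natural (F := comp1 t s) (G := comp1 t' s) (fun x => u (s x)).
  by move=> x y f; have /= -> := ncompP u (fmap s f).
have P' : natural (F := comp1 t' s) (G := comp1 t s) (fun x => u' (s x)).
  by move=> x y f; have /= -> := ncompP u' (fmap s f).
exists (NatTrans P), (NatTrans P').
split=> [||x|x]; [exact: is_mor2_whiskr|exact: is_mor2_whiskr| |].
- exact: H1.
- exact: H2.
Qed.

Lemma iso1_strict (a b : rep2) (s r : mor1 a b)
    (t : forall x, hom (s x) (r x)) (t' : forall x, hom (r x) (s x)) :
    natural t -> (forall x, t' x \c t x = idm (s x)) ->
    (forall x, t x \c t' x = idm (r x)) ->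
    (forall g x, t (act a g x) \c mnat s g x
                 = mnat r g x \c fmap (act b g) (t x)) ->
  iso1 s r.
Proof.
move=> P H1 H2 Ht.
have cancell x y (f f' : hom x (s y)) : t y \c f = t y \c f' -> f = f'.
  by move/(congr1 (comp (t' y))); rewrite !compA H1 !comp1m.
have P' : natural t'.
  move=> x y f; apply: cancell; rewrite !compA H2 comp1m P.
  by rewrite -compA H2 compm1.
exists (NatTrans P), (NatTrans P'); split=> // g x /=.
apply: cancell; rewrite !compA H2 comp1m Ht -compA -fmapM H2.
by rewrite fmap1 compm1.
Qed.

Lemma iso1_assoc (a b c d : rep2) (u : mor1 c d) (t : mor1 b c)
  (s : mor1 a b) : iso1 (comp1 u (comp1 t s)) (comp1 (comp1 u t) s).
Proof.
apply: (@iso1_strict _ _ (comp1 u (comp1 t s)) (comp1 (comp1 u t) s)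
                             (fun x => idm (u (t (s x))))
                             (fun x => idm (u (t (s x))))).
- by move=> x y f; rewrite /= comp1m compm1.
- by move=> x; rewrite /= comp1m.
- by move=> x; rewrite /= comp1m.
- by move=> g x; rewrite /= /comp1_fun /= comp1m fmap1 compm1 fmapM compA.
Qed.

Lemma iso1_idl (a b : rep2) (s : mor1 a b) : iso1 (comp1 (id1 b) s) s.
Proof.
apply: (@iso1_strict _ _ (comp1 (id1 b) s) s
  (fun x => idm (s x)) (fun x => idm (s x))).
- by move=> x y f; rewrite /= comp1m compm1.
- by move=> x; rewrite /= comp1m.
- by move=> x; rewrite /= comp1m.
- by move=> g x; rewrite /= /comp1_fun /= comp1m fmap1 !compm1.
Qed.

Lemma iso1_idr (a b : rep2) (s : mor1 a b) : iso1 (comp1 s (id1 a)) s.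
Proof.
apply: (@iso1_strict _ _ (comp1 s (id1 a)) s
  (fun x => idm (s x)) (fun x => idm (s x))).
- by move=> x y f; rewrite /= comp1m compm1.
- by move=> x; rewrite /= comp1m.
- by move=> x; rewrite /= comp1m.
- by move=> g x; rewrite /= /comp1_fun /= !fmap1 !comp1m compm1.
Qed.

End Iso1.

Section IsoClasses.
Variables a b : rep2.

HB.instance Definition _ := gen_eqMixin (mor1 a b).
HB.instance Definition _ := gen_choiceMixin (mor1 a b).

Definition iso1b (s r : mor1 a b) : bool := `[< iso1 s r >].

Lemma iso1b_refl : reflexive iso1b.
Proof. by move=> s; apply/asboolP/iso1_refl. Qed.
Lemma iso1b_sym : symmetric iso1b.
Proof. by move=> s r; apply/asboolP/asboolP => /iso1_sym. Qed.
Lemma iso1b_trans : transitive iso1b.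
Proof.
move=> s r q /asboolP rs /asboolP sq; apply/asboolP; exact: iso1_trans rs sq.
Qed.

Canonical iso1_equiv := EquivRel iso1b iso1b_refl iso1b_sym iso1b_trans.

Definition isoclass := {eq_quot iso1b}%qT.

Definition cls (s : mor1 a b) : isoclass := (\pi_isoclass s)%qT.

Lemma clsP (s r : mor1 a b) : cls s = cls r <-> iso1 s r.
Proof. by split=> [/eqmodP/asboolP|sr]; last exact/eqmodP/asboolP. Qed.

Lemma cls_repr (q : isoclass) : cls (generic_quotient.repr q) = q.
Proof. exact: reprK. Qed.

End IsoClasses.

Definition ho_comp (a b c : rep2) (q : isoclass b c) (p : isoclass a b)
  : isoclass a c :=
  cls (comp1 (generic_quotient.repr q) (generic_quotient.repr p)).

Lemma ho_compE (a b c : rep2) (t : mor1 b c) (s : mor1 a b) :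
  ho_comp (cls t) (cls s) = cls (comp1 t s).
Proof.
apply/clsP.
apply: (@iso1_trans _ _ _ (comp1 t (generic_quotient.repr (cls s)))).
  by apply: iso1_whiskr; apply/clsP; rewrite cls_repr.
by apply: iso1_whiskl; apply/clsP; rewrite cls_repr.
Qed.

End TwoRep.
End Cats.

Record category := Category {
  cat_obj :> Type;
  cat_hom : cat_obj -> cat_obj -> Type;
  cat_id : forall x, cat_hom x x;
  cat_comp : forall x y z, cat_hom y z -> cat_hom x y -> cat_hom x z;
  cat_compA : forall w x y z (h : cat_hom y z) (g : cat_hom x y)
    (f : cat_hom w x), cat_comp h (cat_comp g f) = cat_comp (cat_comp h g) f;
  cat_comp1m : forall x y (f : cat_hom x y), cat_comp (cat_id y) f = f;
  cat_compm1 : forall x y (f : cat_hom x y), cat_comp f (cat_id x) = f }.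

Definition is_functor (D E : category) (F0 : D -> E)
    (F1 : forall x y, cat_hom x y -> cat_hom (F0 x) (F0 y)) : Prop :=
  (forall x, F1 x x (cat_id x) = cat_id (F0 x)) /\
  (forall x y z (g : cat_hom y z) (f : cat_hom x y),
     F1 x z (cat_comp g f) = cat_comp (F1 y z g) (F1 x y f)).

Section HoRep.
Variables (C : numClosedFieldType) (gT : finGroupType).

Lemma ho_compA (w x y z : rep2 C gT) (h : isoclass y z) (g : isoclass x y)
  (f : isoclass w x) : ho_comp h (ho_comp g f) = ho_comp (ho_comp h g) f.
Proof.
rewrite -(cls_repr f) -(cls_repr g) -(cls_repr h) !ho_compE.
exact/clsP/iso1_assoc.
Qed.

Lemma ho_comp1m (x y : rep2 C gT) (f : isoclass x y) :
  ho_comp (cls (id1 y)) f = f.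
Proof. rewrite -(cls_repr f) ho_compE; exact/clsP/iso1_idl. Qed.

Lemma ho_compm1 (x y : rep2 C gT) (f : isoclass x y) :
  ho_comp f (cls (id1 x)) = f.
Proof. rewrite -(cls_repr f) ho_compE; exact/clsP/iso1_idr. Qed.

(* The category [2Rep(G)] for G = [gT]: 2-representations and isomorphism
   classes of 1-morphisms. *)
Definition ho2Rep : category :=
  @Category (rep2 C gT) (@isoclass C gT) (fun x => cls (id1 x))
    (@ho_comp C gT) ho_compA ho_comp1m ho_compm1.

Record bundle_map (V W : bundle C gT) := BundleMap {
  bmap :> forall g, V g -> W g;
  bmapP : is_bundle_map bmap }.

Lemma bundle_map_ext (V W : bundle C gT) (f f' : bundle_map V W) :
  (forall g v, f g v = f' g v) -> f = f'.
Proof.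
case: f f' => [f fP] [f' fP'] /= ff'.
have {}ff' : f = f'.
  apply: functional_extensionality_dep => g.
  exact: functional_extensionality_dep.
by case: _ / ff' in fP' *; rewrite (Prop_irrelevance fP fP').
Qed.

Lemma bundle_idP (V : bundle C gT) : is_bundle_map (fun g (v : V g) => v).
Proof. by []. Qed.

Lemma bundle_compP (V W X : bundle C gT) (f : bundle_map W X)
  (f' : bundle_map V W) : is_bundle_map (fun g (v : V g) => f g (f' g v)).
Proof.
case: (bmapP f) (bmapP f') => fl fe [fl' fe']; split=> [g k u v|h g v].
  by rewrite fl' fl.
by rewrite fe' fe.
Qed.

Definition bundle_id (V : bundle C gT) : bundle_map V V :=
  BundleMap (bundle_idP V).

Definition bundle_comp (V W X : bundle C gT) (f : bundle_map W X)
  (f' : bundle_map V W) : bundle_map V X := BundleMap (bundle_compP f f').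

Lemma bundle_compA (V W X Y : bundle C gT) (h : bundle_map X Y)
  (g : bundle_map W X) (f : bundle_map V W) :
  bundle_comp h (bundle_comp g f) = bundle_comp (bundle_comp h g) f.
Proof. exact: bundle_map_ext. Qed.

Lemma bundle_comp1m (V W : bundle C gT) (f : bundle_map V W) :
  bundle_comp (bundle_id W) f = f.
Proof. exact: bundle_map_ext. Qed.

Lemma bundle_compm1 (V W : bundle C gT) (f : bundle_map V W) :
  bundle_comp f (bundle_id V) = f.
Proof. exact: bundle_map_ext. Qed.

(* The category Hilb_G(G) for G = [gT]. *)
Definition HilbG : category :=
  @Category (bundle C gT) bundle_map bundle_id bundle_comp
    bundle_compA bundle_comp1m bundle_compm1.

End HoRep.

(* Main.v *)
From HB Require Import structures.
From mathcomp Require Import all_boot all_order all_algebra all_fingroup.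
From mathcomp Require Import complex reals boolp spectral.
Require Import Defs.

Set Implicit Arguments.
Unset Strict Implicit.
Unset Printing Implicit Defensive.

Import Order.TTheory GRing.Theory Num.Theory.

(** For a 1-morphism sigma and an object y of its target, call (c, u) an even
    pair at y, with object r, when c : sigma r -> y represents Hom(sigma -, y)
    and u : y -> sigma r satisfies (id_r, v) = (u c, sigma v) for every
    endomorphism v of r. The counit of a right adjoint and the unit given by
    the even-handed structure form an even pair at every object, because that
    structure is defined by the equation above. Conversely u is determined by
    (r, c), and the comparison map between two representing objects carries one
    unit to the other ([even_pair_transport]). Hence the formula for chi(sigma)
    at y may be computed from any even pair at y ([chi_morE]), and each claim about
    chi(sigma) reduces to exhibiting a convenient even pair:
    - a second right adjoint gives another even pair, whence independence;
    - an isomorphism of 1-morphisms, unitary or not, transports even pairs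
      ([even_pair_iso]);
    - even pairs compose ([even_pair_comp]) and identities form one;
    - the action of h, being a unitary equivalence, turns an even pair at z into
      one at h z ([even_pair_act]); this gives equivariance.

    For the bundle chi_alpha, the transform of theta under h is characterised by
    its values on objects h x, through an equation between composites of the
    multiplication constraints that does not mention h^-1 ([is_translate]). The
    bundle laws follow from the uniqueness of such a transform. Its inner
    product is invariant because h permutes the simple objects up to unitary
    isomorphism, and each summand depends only on the unitary isomorphism class
    of its simple object.

    Existence of adjoints, and finite-dimensionality of the spaces of natural
    transformations, rest on semisimplicity. In an H*-algebra every right ideal
    of End(x) is generated by an idempotent ([right_ideal_projection]); since
    idempotents split this yields Schur's lemma, and the decomposition of every
    identity as a sum of morphisms factoring through simples ([semisimple]). The
    right adjoint at y is then the sum of the simples e_i with multiplicity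
    dim Hom(sigma e_i, y); choosing orthonormal bases on both sides makes the
    counit isometric on Hom(e_i, -), so that the adjoint commutes with *. *)

(** * Orthonormal families in finite dimension *)

Section LinearAlgebra.
Local Open Scope ring_scope.
Variable C : numClosedFieldType.

Definition has_dim (V : lmodType C) (n : nat) : Prop :=
  exists f : {linear V -> 'rV[C]_n}, bijective f.

Lemma linear_bundled (V W : lmodType C) (f : V -> W) :
  linear f -> exists g : {linear V -> W}, g =1 f.
Proof.
move=> fl; pose g := HB.pack_for {linear V -> W} f
  (GRing.isLinear.Build C V W _ f fl).
by exists g.
Qed.

Lemma has_dim_linear (V : lmodType C) n (f : V -> 'rV[C]_n) :
  linear f -> bijective f -> has_dim V n.
Proof.
move=> /linear_bundled[g gf] fb; exists g.
by apply: (eq_bij fb) => v; rewrite gf.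
Qed.

Lemma linear_sumZ (V W : lmodType C) (f : V -> W) (I : finType)
    (a : I -> C) (F : I -> V) :
  linear f -> f (\sum_i a i *: F i) = \sum_i a i *: f (F i).
Proof.
move=> /linear_bundled[g gf]; rewrite -gf linear_sum.
by apply: eq_bigr => i _; rewrite linearZ gf.
Qed.

Lemma linear_eq0 (V W : lmodType C) (f : V -> W) : linear f -> f 0 = 0.
Proof. by move=> /linear_bundled[g gf]; rewrite -gf linear0. Qed.

(** The rows of coordinates of an independent family form a row-free
    matrix, whose rank is both its height and at most its width. *)
Lemma independent_size (V : lmodType C) n (f : V -> 'rV[C]_n)
    m (b : 'I_m -> V) : linear f -> injective f ->
  (forall d : 'I_m -> C, \sum_i d i *: b i = 0 -> forall i, d i = 0) ->
  (m <= n)%N.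
Proof.
move=> fl fi b_free; pose M : 'M[C]_(m, n) := \matrix_i f (b i).
suff /eqP <- : row_free M by rewrite rank_leq_col.
rewrite -kermx_eq0; apply/eqP/row_matrixP => k; rewrite row0.
set d := row k _; have dM : d *m M = 0 by rewrite -row_mul mulmx_ker row0.
apply/rowP => i; rewrite [RHS]mxE; apply: (b_free (fun i => d 0 i)); apply: fi.
rewrite linear_eq0 // linear_sumZ // -[RHS]dM mulmx_sum_row.
by apply: eq_bigr => j _; rewrite rowK.
Qed.

Definition orthonormal (V : prehilb C) m (b : 'I_m -> V) : Prop :=
  forall i j, ip (b i) (b j) = (i == j)%:R.

Definition spans (V : prehilb C) (P : V -> Prop) m (b : 'I_m -> V) : Prop :=
  forall w, P w -> w = \sum_i ip (b i) w *: b i.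

Definition subspace (V : lmodType C) (P : V -> Prop) : Prop :=
  P 0 /\ forall a u v, P u -> P v -> P (a *: u + v).

Lemma subspace_sum (V : lmodType C) (P : V -> Prop) (I : finType)
    (a : I -> C) (F : I -> V) :
  subspace P -> (forall i, P (F i)) -> P (\sum_i a i *: F i).
Proof. by move=> [P0 PD] PF; elim/big_rec: _ => // i v _; apply: PD. Qed.

Section Orthonormal.
Variables (V : prehilb C) (n : nat) (f : V -> 'rV[C]_n).
Hypotheses (f_linear : linear f) (f_inj : injective f).
Hypothesis ip_scalar : forall u : V, scalar (ip u).
Hypothesis ip_hermitian : forall u v : V, ip v u = (ip u v)^*.
Hypothesis ip_pos : forall v : V, v != 0 -> 0 < ip v v.

Let ip_lin (u : V) : linear (ip u : V -> C^o).
Proof. by move=> a v w; apply: ip_scalar. Qed.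

Lemma orthonormal_coef m (b : 'I_m -> V) (d : 'I_m -> C) j :
  orthonormal b -> ip (b j) (\sum_i d i *: b i) = d j.
Proof.
move=> bo; rewrite (linear_sumZ _ _ (ip_lin (b j))).
rewrite (bigD1 j) //= bo eqxx big1 => [|i ij].
  by rewrite addr0 /GRing.scale /= mulr1.
by rewrite bo eq_sym (negPf ij) scaler0.
Qed.

Lemma orthonormal_size m (b : 'I_m -> V) : orthonormal b -> (m <= n)%N.
Proof.
move=> bo; apply: (independent_size f_linear f_inj (b := b)) => d d0 i.
by rewrite -(orthonormal_coef d i bo) d0 (linear_eq0 (ip_lin (b i))).
Qed.

(** A maximal orthonormal family in a subspace spans it, since otherwise
    the normalised remainder of some vector would extend it. *)
Lemma orthonormal_basis (P : V -> Prop) : subspace P ->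
  exists m (b : 'I_m -> V),
    [/\ orthonormal b, forall i, P (b i) & spans P b].
Proof.
move=> Psub; case: (Psub) => P0 PD.
pose family m :=
  `[< exists b : 'I_m -> V, orthonormal b /\ forall i, P (b i) >].
have family0 : exists m, family m.
  by exists 0%N; apply/asboolP; exists (fun=> 0); split=> -[].
have family_le m : family m -> (m <= n)%N.
  by move=> /asboolP[b [/orthonormal_size]].
case: (ex_maxnP family0 family_le) => m /asboolP[b [bo bP]] m_max.
exists m, b; split=> // w Pw; set p := \sum_i _.
apply/eqP; rewrite -subr_eq0; apply: contraT => r_neq0.
set r := w - p in r_neq0.
have Pr : P r.
  by rewrite /r -scaleN1r addrC; apply: PD => //; apply: subspace_sum.
have br i : ip (b i) r = 0.
  rewrite /r addrC -scaleN1r (ip_lin (b i)) orthonormal_coef //.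
  by rewrite scaleN1r addNr.
have rr := ip_pos r_neq0; pose s := sqrtC (ip r r).
have s_gt0 : 0 < s by rewrite sqrtC_gt0.
have ipZ (a : C) (u v : V) : ip u (a *: v) = a * ip u v.
  by have := ip_lin u a v 0; rewrite addr0 (linear_eq0 (ip_lin u)) addr0.
pose b' (i : 'I_m.+1) : V := if unlift ord0 i is Some j then b j else s^-1 *: r.
suff /m_max : family m.+1 by rewrite ltnn.
apply/asboolP; exists b'; split=> [i j|i].
  rewrite /b'; case: unliftP => [i' ->|->]; case: unliftP => [j' ->|->].
  - by rewrite bo (inj_eq (@lift_inj _ _)).
  - by rewrite ipZ br mulr0 eq_sym eq_liftF.
  - by rewrite ip_hermitian ipZ br mulr0 conjC0 eq_liftF.
  rewrite ipZ ip_hermitian ipZ rmorphM /= fmorphV /= -ip_hermitian.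
  rewrite (CrealP (ger0_real (ltW s_gt0))) -[ip r r]sqrtCK -/s expr2.
  by rewrite mulKf ?mulVf ?gt_eqF.
rewrite /b'; case: unliftP => [//|_].
by rewrite -[_ *: r]addr0; apply: PD.
Qed.

(** Stated for a positive definite form on a space that is not yet known to be
    finite-dimensional, so as to apply to spaces of natural transformations. *)
Lemma has_dim_embedded : exists m, has_dim V m.
Proof.
have [|m [b [bo _ bs]]] := @orthonormal_basis (fun _ => True).
  by split.
exists m; apply: (@has_dim_linear _ _ (fun v => \row_i ip (b i) v)).
  by move=> a u v; apply/rowP => i; rewrite !mxE ip_scalar.
exists (fun r : 'rV[C]_m => \sum_i r 0 i *: b i) => [v|r].
  by rewrite [RHS]bs //; apply: eq_bigr => i _; rewrite mxE.
by apply/rowP => i; rewrite mxE orthonormal_coef.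
Qed.

End Orthonormal.

Lemma hilb_has_dim (V : hilb C) : exists n, has_dim V n.
Proof. by case: (hilbP V). Qed.

Lemma hilb_basis (V : hilb C) (P : V -> Prop) : subspace P ->
  exists m (b : 'I_m -> V), [/\ orthonormal b, forall i, P (b i) & spans P b].
Proof.
case: (hilb_has_dim V) => n [f fb].
exact: (orthonormal_basis (linearP f) (bij_inj fb) (@ip_linr C V)
  (@ip_herm C V) (@ip_gt0 C V)).
Qed.

(** The basis given by [hilb_basis] has the right size because the size of an
    independent family is bounded by the size of any coordinate system. *)
Lemma hilb_basis_of_dim (V : hilb C) n : has_dim V n ->
  exists b : 'I_n -> V, orthonormal b /\ spans (fun _ => True) b.
Proof.
case=> f fb; have [|m [b [bo _ bs]]] := @hilb_basis V (fun _ => True).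
  by split.
suff mn : m = n by case: _ / mn; exists b.
apply/eqP; rewrite eqn_leq; apply/andP; split.
  exact: (orthonormal_size (linearP f) (bij_inj fb) (@ip_linr C V)) bo.
case: fb => g fK gK.
apply: (@independent_size V m (fun v => \row_i ip (b i) v) n
  (fun i => g (delta_mx 0 i))).
- by move=> a u v; apply/rowP => i; rewrite !mxE ip_linr.
- move=> u v uv; rewrite (bs u) // (bs v) //; apply: eq_bigr => i _.
  by have /rowP/(_ i) := uv; rewrite !mxE => ->.
move=> d /(congr1 f); rewrite linear0 linear_sum => /rowP d0 i.
have := d0 i; rewrite summxE (bigD1 i) //= big1 => [|j ji].
  by rewrite linearZ gK !mxE !eqxx mulr1 addr0.
by rewrite linearZ gK !mxE eqxx eq_sym (negPf ji) mulr0.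
Qed.

Lemma orthogonal_projection (V : hilb C) (P : V -> Prop) (v : V) :
  subspace P -> exists2 p, P p & forall w, P w -> ip w (v - p) = 0.
Proof.
move=> Psub; case: (hilb_basis Psub) => m [b [bo bP bs]].
exists (\sum_i ip (b i) v *: b i); first exact: subspace_sum.
move=> w /bs ->; rewrite ip_suml big1 // => i _; rewrite ipZl ipBr.
by rewrite (orthonormal_coef (@ip_linr C V)) // subrr mulr0.
Qed.

End LinearAlgebra.

(** * Calculus in H*-categories *)

Section Calculus.
Local Open Scope ring_scope.
Variables (C : numClosedFieldType) (H : hstarCat C).
Implicit Types x y z : H.

Lemma compBl x y z (f g : hom y z) (h : hom x y) :
  (f - g) \c h = f \c h - g \c h.
Proof. by rewrite compDl compNl. Qed.

Lemma compBr x y z (f g : hom x y) (h : hom y z) :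
  h \c (f - g) = h \c f - h \c g.
Proof. by rewrite compDr compNr. Qed.

Lemma inverse_unique x y (f : hom x y) (l r : hom y x) :
  l \c f = idm x -> f \c r = idm y -> l = r.
Proof. by move=> lf fr; rewrite -[l]compm1 -fr compA lf comp1m. Qed.

(** With composites associated to the right, these rules apply an equation
    between composites inside a longer composite. *)
Lemma slide (w x y z : H) (f : hom y z) (g : hom x y) (p : hom x z) :
  f \c g = p -> forall k : hom w x, f \c (g \c k) = p \c k.
Proof. by move=> <- k; rewrite compA. Qed.

Lemma slide3 (v w x y z : H) (f : hom y z) (g : hom x y) (h : hom w x)
    (p : hom w z) :
  f \c (g \c h) = p -> forall k : hom v w, f \c (g \c (h \c k)) = p \c k.
Proof. by move=> <- k; rewrite !compA. Qed.

Lemma starZ x y a (f : hom x y) : star (a *: f) = a^* *: star f.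
Proof.
have s0 : star (0 : hom x y) = 0.
  apply: (addIr (star 0)); rewrite add0r.
  by have := star_anti 1 (0 : hom x y) 0; rewrite rmorph1 !scale1r addr0.
by have := star_anti a f 0; rewrite !addr0 s0 addr0.
Qed.

Lemma ip_idl x y (f g : hom x y) : ip f g = ip (idm x) (star f \c g).
Proof. by rewrite -ip_compl compm1. Qed.

Lemma ip_idr x y (f g : hom x y) : ip f g = ip (idm y) (g \c star f).
Proof. by rewrite -ip_compr comp1m. Qed.

Lemma star_comp_eq0 x y (f : hom x y) : star f \c f = 0 -> f = 0.
Proof. by move=> ff0; apply: ip_eq0; rewrite ip_idl ff0 ip0r. Qed.

Lemma comp_star_eq0 x y (f : hom x y) : f \c star f = 0 -> f = 0.
Proof. by move=> ff0; apply: ip_eq0; rewrite ip_idr ff0 ip0r. Qed.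

Lemma ip_id_gt0 x : idm x <> 0 -> 0 < ip (idm x) (idm x).
Proof. by move=> /eqP; apply: ip_gt0. Qed.

(** The projection of the identity is a generator. For q = id - p and u in the
    ideal, q u lies in the ideal, and it is orthogonal to each w in the ideal as
    (q u, w) is (q, w u') where u' is the adjoint of u. Hence q u = 0. *)
Lemma right_ideal_projection x (P : hom x x -> Prop) :
  subspace P -> (forall u v, P u -> P (u \c v)) ->
  exists p, [/\ P p, p \c p = p & forall u, P u -> p \c u = u].
Proof.
move=> Psub PM; have [p Pp p_orth] := orthogonal_projection (idm x) Psub.
have pu u : P u -> p \c u = u.
  move=> Pu; pose d := (idm x - p) \c u.
  have Pd : P d.
    rewrite /d compBl comp1m addrC -scaleN1r; apply: (proj2 Psub) => //.
    exact: PM.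
  have : d = 0.
    apply: ip_eq0; rewrite {1}/d ip_compr ip_herm p_orth ?conjC0 //.
    exact: PM.
  by rewrite /d compBl comp1m => /eqP; rewrite subr_eq0 => /eqP.
by exists p; split=> //; apply: pu.
Qed.

Lemma simple_neq0 x : simple_obj x -> idm x <> 0. Proof. by case. Qed.

End Calculus.

Section Unitaries.
Local Open Scope ring_scope.
Variables (C : numClosedFieldType) (H : hstarCat C).
Implicit Types x y z : H.

Lemma unitary_injl x y z (u : hom y z) (f g : hom x y) :
  unitary_mor u -> u \c f = u \c g -> f = g.
Proof.
by move=> [uu _] /(congr1 (comp (star u))); rewrite !compA uu !comp1m.
Qed.

Lemma unitary_injr x y z (u : hom x y) (f g : hom y z) :
  unitary_mor u -> f \c u = g \c u -> f = g.
Proof.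
move=> [_ uu] /(congr1 (fun v => v \c star u)).
by rewrite -!compA uu !compm1.
Qed.

Lemma iso_obj_sym x y : iso_obj x y -> iso_obj y x.
Proof. by case=> f [g [gf fg]]; exists g, f. Qed.

Lemma iso_obj_trans x y z : iso_obj x y -> iso_obj y z -> iso_obj x z.
Proof.
move=> [f [f' [ff' f'f]]] [g [g' [gg' g'g]]]; exists (g \c f), (f' \c g').
by rewrite -!compA (slide gg') comp1m (slide f'f) comp1m.
Qed.

Lemma ip_unitaryl x y z (u : hom y z) (f g : hom x y) :
  unitary_mor u -> ip (u \c f) (u \c g) = ip f g.
Proof. by move=> [uu _]; rewrite ip_compl compA uu comp1m. Qed.

Lemma ip_unitaryr x y z (u : hom x y) (f g : hom y z) :
  unitary_mor u -> ip (f \c u) (g \c u) = ip f g.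
Proof. by move=> [_ uu]; rewrite ip_compr -compA uu compm1. Qed.

Lemma ip_id_unitary x y (u : hom x y) :
  unitary_mor u -> ip (idm y) (idm y) = ip (idm x) (idm x).
Proof.
move=> uu; rewrite -(ip_unitaryr _ _ uu) comp1m.
by rewrite -(ip_unitaryl (idm x) (idm x) uu) compm1.
Qed.

(** The reason why the inner product of natural transformations does not depend
    on the choice of representative simples. *)
Lemma ip_nat_unitary (F : lsfunctor H H) (t t' : nat_trans (idF H) F) x y
    (u : hom x y) :
  unitary_mor u -> ip (t y) (t' y) = ip (t x) (t' x).
Proof.
move=> uu; rewrite -(ip_unitaryr _ _ uu).
have /= -> := ncompP t u; have /= -> := ncompP t' u.
exact/ip_unitaryl/unitary_fmap.
Qed.

End Unitaries.

Section LinearStarFunctors.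
Local Open Scope ring_scope.
Variables (C : numClosedFieldType) (H K : hstarCat C) (F : lsfunctor H K).

Lemma fmap_lin x y : linear (@fmap C H K F x y).
Proof. by case: (lsfP F). Qed.

Lemma fmap_star x y (f : hom x y) : fmap F (star f) = star (fmap F f).
Proof. by case: (lsfP F). Qed.

Lemma fmap0 x y : fmap F (0 : hom x y) = 0.
Proof. exact: linear_eq0 (@fmap_lin x y). Qed.

Lemma fmapD x y (f g : hom x y) : fmap F (f + g) = fmap F f + fmap F g.
Proof. by have := fmap_lin 1 f g; rewrite !scale1r. Qed.

Lemma fmapZ x y a (f : hom x y) : fmap F (a *: f) = a *: fmap F f.
Proof. by have := fmap_lin a f 0; rewrite fmap0 !addr0. Qed.

End LinearStarFunctors.

(** * Simple objects and Schur's lemma *)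

Section Schur.
Local Open Scope ring_scope.
Variables (C : numClosedFieldType) (H : hstarCat C).
Hypothesis H_split : idempotents_split H.
Implicit Types x y z : H.

(** The annihilator of K is a right ideal, so it is generated by an
    idempotent, whose image is a subobject of the simple object. *)
Lemma simple_integral x (K u : hom x x) : simple_obj x ->
  K \c u = 0 -> K = 0 \/ u = 0.
Proof.
move=> [_ x_simple] Ku.
have [||p [Kp pp pP]] := @right_ideal_projection _ H x (fun v => K \c v = 0).
- split=> [|a v w Kv Kw]; first by rewrite comp0r.
  by rewrite compDr compZr Kv Kw scaler0 addr0.
- by move=> v w Kv; rewrite compA Kv comp0l.
have [y [r [s [sr rs]]]] := H_split pp.
have s_mono : mono_mor s.
  by move=> w v v' svv'; rewrite -[v]comp1m -rs -compA svv' compA rs comp1m.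
case: (x_simple _ _ s_mono) => [s0|[t [ts st]]].
  by right; rewrite -(pP _ Ku) -sr s0 !comp0l.
left; suff p1 : p = idm x by rewrite -[K]compm1 -p1.
by rewrite -sr (inverse_unique rs st).
Qed.

(** Left multiplication by f on End(x) has an eigenvalue a, so that f - a id is
    a zero divisor. *)
Lemma schur x (f : hom x x) : simple_obj x -> exists a : C, f = a *: idm x.
Proof.
move=> x_simple; have [n [g gb]] := hilb_has_dim (hom x x).
case: (gb) => g' gK g'K.
have n_gt0 : (0 < n)%N.
  case: n g gb g' gK g'K => // g gb g' gK g'K.
  case: (simple_neq0 x_simple); apply: (can_inj gK).
  by apply/rowP => -[].
have g'l : linear g' by exact: (can2_linear gK g'K).
have Ll : linear (fun v => g (f \c g' v)).
  by move=> a u v; rewrite g'l compDr compZr linearP.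
have [L LE] := linear_bundled Ll.
have [a /eigenvalueP[v vL v0]] := eigenvalue_closed (lin1_mx L) n_gt0.
have fv : f \c g' v = a *: g' v.
  apply: (can_inj gK); rewrite linearZ /= g'K -vL mul_rV_lin1.
  by rewrite LE.
exists a; case: (@simple_integral x (f - a *: idm x) (g' v) x_simple).
- by rewrite compBl compZl comp1m fv subrr.
- by move/eqP; rewrite subr_eq0 => /eqP.
- by move=> g'v0; case/eqP: v0; rewrite -[v]g'K g'v0 linear0.
Qed.

End Schur.

Section Scalars.
Local Open Scope ring_scope.
Variables (C : numClosedFieldType) (H : hstarCat C).
Implicit Types x y z : H.

(** By Schur's lemma this is a characterisation of simple objects. It mentions
    no subobjects, so full and faithful linear functors visibly
    preserve it. *)
Definition scalar_end x : Prop :=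
  idm x <> 0 /\ forall f : hom x x, exists a : C, f = a *: idm x.

Lemma scalar_coef x (f : hom x x) : scalar_end x ->
  f = (ip (idm x) f / ip (idm x) (idm x)) *: idm x.
Proof.
move=> [x0 xS]; have [a ->] := xS f.
by rewrite ipZr mulfK // gt_eqF // ip_id_gt0.
Qed.

(** If m is a non-zero mono into x, then m m^* is a non-zero scalar,
    which makes m a split epi. *)
Lemma scalar_end_simple x : scalar_end x -> simple_obj x.
Proof.
move=> [x0 xS]; split=> // s m m_mono.
have [a mm] := xS (m \c star m); case: (eqVneq a 0) => [a0|a0].
  by left; apply: comp_star_eq0; rewrite mm a0 scale0r.
have mr : m \c (a^-1 *: star m) = idm x.
  by rewrite compZr mm scalerA mulVf // scale1r.
right; exists (a^-1 *: star m); split=> //.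
by apply: m_mono; rewrite compA mr comp1m compm1.
Qed.

(** The polar decomposition of a map out of an object with scalar
    endomorphisms only rescales it. *)
Lemma iso_unitary x y : scalar_end x -> iso_obj x y ->
  exists u : hom x y, unitary_mor u.
Proof.
move=> [x0 xS] [f [g [gf fg]]]; have [a fa] := xS (star f \c f).
have k_gt0 := ip_id_gt0 x0.
have f0 : f != 0.
  by apply/eqP => f0; apply: x0; rewrite -gf f0 comp0r.
have a_gt0 : 0 < a.
  have := ip_gt0 f0; rewrite ip_idl fa ipZr.
  by rewrite pmulr_lgt0.
pose s := sqrtC a; have s_gt0 : 0 < s by rewrite sqrtC_gt0.
have ss : s^-1 * s^-1 * a = 1.
  rewrite -[a]sqrtCK -/s expr2 mulrACA mulVf ?mulr1 // gt_eqF //.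
pose u := s^-1 *: f.
have uu : star u \c u = idm x.
  rewrite starZ compZl compZr fa !scalerA fmorphV /=.
  by rewrite (CrealP (ger0_real (ltW s_gt0))) ss scale1r.
exists u; split=> //.
have ur : u \c (s *: g) = idm y.
  by rewrite compZl compZr scalerA mulVf ?scale1r ?gt_eqF.
by rewrite (inverse_unique uu ur).
Qed.

(** If f is non-zero then its composites with its adjoint are non-zero scalars,
    and f is invertible. *)
Lemma scalar_end_hom0 x y (f : hom x y) :
  scalar_end x -> scalar_end y -> ~ iso_obj x y -> f = 0.
Proof.
move=> [x0 xS] [y0 yS] xy.
have [a fa] := xS (star f \c f); have [b fb] := yS (f \c star f).
case: (eqVneq f 0) => // f0; case: xy.
have a0 : a != 0.
  by apply: contraNneq f0 => a0; apply/eqP/star_comp_eq0; rewrite fa a0 scale0r.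
have b0 : b != 0.
  by apply: contraNneq f0 => b0; apply/eqP/comp_star_eq0; rewrite fb b0 scale0r.
have fl : (a^-1 *: star f) \c f = idm x.
  by rewrite compZl fa scalerA mulVf // scale1r.
have fr : f \c (b^-1 *: star f) = idm y.
  by rewrite compZr fb scalerA mulVf // scale1r.
exists f, (a^-1 *: star f); split=> //.
by rewrite (inverse_unique fl fr).
Qed.

End Scalars.

(** * Semisimplicity *)

Section Semisimple.
Local Open Scope ring_scope.
Variables (C : numClosedFieldType) (H : twoHilb C).
Variables (n : nat) (e : 'I_n -> H).
Hypothesis eP : simple_reps e.
Implicit Types x y z : H.

Lemma simple_scalar x : simple_obj x -> scalar_end x.
Proof.
move=> x_simple; split=> [|f]; first exact: simple_neq0.
by have [a ->] := schur (@tsplit _ H) f x_simple; exists a.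
Qed.

Lemma reps_scalar i : scalar_end (e i).
Proof. by apply: simple_scalar; case: eP. Qed.

Lemma reps_hom0 i j (f : hom (e i) (e j)) : i <> j -> f = 0.
Proof.
move=> ij; apply: scalar_end_hom0; [exact: reps_scalar|exact: reps_scalar|].
by case: eP => _ e_inj _ /e_inj.
Qed.

(** The ideal of finite sums of morphisms through the representative simples.
    Its induction principle replaces explicit decompositions into simples. *)
Inductive via_simples x y : hom x y -> Prop :=
| via_simples_zero : via_simples 0
| via_simples_add f g : via_simples f -> via_simples g -> via_simples (f + g)
| via_simples_simple i (q : hom (e i) y) (p : hom x (e i)) :
    via_simples (q \c p).

Lemma via_simples_comp x y z w (f : hom y z) (g : hom x y) (h : hom z w) :
  via_simples f -> via_simples (h \c f \c g).
Proof.
elim=> [|f1 f2 _ IH1 _ IH2|i q p].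
- by rewrite comp0r comp0l; constructor.
- by rewrite compDr compDl; constructor.
- by rewrite compA -compA; constructor.
Qed.

Definition idem_family x m : Prop := exists p : 'I_m -> hom x x,
  [/\ forall i, p i <> 0, forall i, p i \c p i = p i
    & forall i j, i != j -> p i \c p j = 0].

Lemma idem_family_bounded x : exists N, forall m, idem_family x m -> (m <= N)%N.
Proof.
have [N [f fb]] := hilb_has_dim (hom x x); exists N => m [p [p0 pp pq]].
apply: (independent_size (linearP f) (bij_inj fb) (b := p)) => d d0 i.
have : p i \c \sum_j d j *: p j = d i *: p i.
  rewrite (linear_sumZ _ _ (comp_linr (p i))) (bigD1 i) //= pp.
  rewrite big1 => [|j ji]; first by rewrite addr0.
  by rewrite pq ?scaler0 // eq_sym.
rewrite d0 comp0r => /esym/eqP; rewrite scaler_eq0.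
by case/orP => /eqP // /p0.
Qed.

(** The family is conjugated into End(x), where the complement of q becomes an
    additional member. *)
Lemma idem_family_extend x y (q : hom x x) (r : hom x y) (s : hom y x) m :
  q <> idm x -> s \c r = q -> r \c s = idm y ->
  idem_family y m -> idem_family x m.+1.
Proof.
move=> q1 sr rs [p [p0 pp pq]].
have qs : q \c s = s by rewrite -sr -compA rs compm1.
have rq : r \c q = r by rewrite -sr compA rs comp1m.
have qq : q \c q = q by rewrite -{1}sr -compA rq sr.
pose t i := s \c p i \c r.
have tt i j : t i \c t j = s \c (p i \c p j) \c r.
  by rewrite /t !compA -[_ \c r \c s]compA rs compm1.
have tE i : r \c t i \c s = p i.
  by rewrite /t !compA rs comp1m -compA rs compm1.
have tq i : t i \c (idm x - q) = 0.
  by rewrite /t compBr compm1 -!compA rq subrr.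
have qt i : (idm x - q) \c t i = 0.
  by rewrite /t compBl comp1m !compA qs subrr.
exists (fun i => if unlift ord0 i is Some j then t j else idm x - q).
split=> [i|i|i j].
- case: unliftP => [j _ tj0|_ /eqP]; last by rewrite subr_eq0 => /eqP /esym.
  by apply: (p0 j); rewrite -tE tj0 comp0r comp0l.
- case: unliftP => [j _|_]; first by rewrite tt pp.
  by rewrite compBr compm1 compBl comp1m qq subrr subr0.
case: unliftP => [i' ->|->]; case: unliftP => [j' ->|->] //.
rewrite (inj_eq (@lift_inj _ _)) => ij.
by rewrite tt pq // comp0r comp0l.
Qed.

(** A non-simple object splits off an idempotent different from 0 and 1;
    both images carry shorter families of orthogonal idempotents. *)
Theorem semisimple x : via_simples (idm x).
Proof.
have [N] := idem_family_bounded x; elim: N x => [|N IH] x xN.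
  suff -> : idm x = 0 by constructor.
  apply: contrapT => x0; suff /xN : idem_family x 1 by [].
  exists (fun=> idm x); split=> // [_|i j]; first by rewrite comp1m.
  by rewrite !ord1.
have via_simples_idem (q : hom x x) : q \c q = q -> q <> idm x -> via_simples q.
  move=> qq q1; have [y [r [s [sr rs]]]] := @tsplit _ H x q qq.
  have -> : q = s \c idm y \c r by rewrite compm1.
  by apply/via_simples_comp/IH => m /(idem_family_extend q1 sr rs)/xN.
case: (pselect (idm x = 0)) => [->|x0]; first by constructor.
case: (pselect (simple_obj x)) => [x_simple|].
  case: eP => _ _ /(_ x x_simple)[i [f [g [gf fg]]]].
  by rewrite -gf; constructor.
move=> not_simple.
have [s [m [m_mono m0 m_iso]]] : exists s (m : hom s x),
    [/\ mono_mor m, m <> 0 & ~ iso_mor m].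
  apply: contrapT => no_m; apply: not_simple; split=> // s m m_mono.
  case: (pselect (m = 0)) => [|m0]; [by left | right].
  by apply: contrapT => m_iso; apply: no_m; exists s, m.
have [||p [[v pv] pp pP]] := @right_ideal_projection _ H x
    (fun u => exists v : hom x s, u = m \c v).
- split=> [|a u u' [v ->] [v' ->]]; first by exists 0; rewrite comp0r.
  by exists (a *: v + v'); rewrite compDr compZr.
- by move=> u w [v ->]; exists (v \c w); rewrite compA.
have p1 : p <> idm x.
  move=> p1; apply: m_iso; exists v; rewrite -pv p1; split=> //.
  by apply: m_mono; rewrite compA -pv p1 comp1m compm1.
have p0 : idm x - p <> idm x.
  move=> /eqP; rewrite -subr_eq0 addrAC subrr add0r oppr_eq0 => /eqP p0.
  apply: m0; apply: comp_star_eq0; rewrite -(pP (m \c star m)).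
    by rewrite p0 comp0l.
  by exists (star m).
rewrite -[idm x](subrK p); constructor; apply: via_simples_idem => //.
by rewrite compBr compm1 compBl comp1m pp subrr subr0.
Qed.

End Semisimple.

(** * Existence of right adjoints *)

Section Dimensions.
Local Open Scope ring_scope.
Variable C : numClosedFieldType.

Lemma has_dim0 (V : lmodType C) : (forall v : V, v = 0) -> has_dim V 0.
Proof.
move=> V0; apply: (@has_dim_linear _ _ _ (fun=> 0)).
  by move=> a u v; rewrite scaler0 addr0.
by exists (fun=> 0) => [v|r]; [exact/esym/V0 | apply/rowP => -[]].
Qed.

Lemma has_dim_add (U V W : lmodType C) m n (p1 : W -> U) (p2 : W -> V)
    (i1 : U -> W) (i2 : V -> W) :
  linear p1 -> linear p2 ->
  cancel i1 p1 -> cancel i2 p2 -> (forall v, p1 (i2 v) = 0) ->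
  (forall u, p2 (i1 u) = 0) -> (forall w, i1 (p1 w) + i2 (p2 w) = w) ->
  has_dim U m -> has_dim V n -> has_dim W (m + n).
Proof.
move=> p1l p2l i1K i2K p1i2 p2i1 iD [f [f' fK f'K]] [g [g' gK g'K]].
apply: (@has_dim_linear _ _ _ (fun w => row_mx (f (p1 w)) (g (p2 w)))).
  by move=> a u v; rewrite p1l p2l !linearP scale_row_mx add_row_mx.
have pD (X : lmodType C) (p : W -> X) x y : linear p -> p (x + y) = p x + p y.
  by move=> pl; have := pl 1 x y; rewrite !scale1r.
exists (fun r : 'rV[C]_(m + n) => i1 (f' (lsubmx r)) + i2 (g' (rsubmx r))).
  by move=> w; rewrite row_mxKl row_mxKr fK gK iD.
move=> r; rewrite !pD // i1K i2K p1i2 p2i1 addr0 add0r f'K g'K.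
exact: hsubmxK.
Qed.

End Dimensions.

Section Multiplicities.
Local Open Scope ring_scope.
Variables (C : numClosedFieldType) (H : twoHilb C).
Variables (n : nat) (e : 'I_n -> H).
Hypothesis eP : simple_reps e.

Lemma has_dim_reps i j : has_dim (hom (e i) (e j)) (j == i).
Proof.
have eS := reps_scalar eP i.
case: eqVneq => [->|/eqP ji]; last first.
  by apply: has_dim0 => f; apply: (reps_hom0 eP) => ij; case: ji.
have k0 : ip (idm (e i)) (idm (e i)) != 0.
  by rewrite gt_eqF ?ip_id_gt0 //; case: eS.
apply: (@has_dim_linear _ _ _
  (fun f => const_mx (ip (idm (e i)) f / ip (idm (e i)) (idm (e i))))).
  by move=> a f g; apply/rowP => l; rewrite !mxE ip_linr mulrDl mulrA.
exists (fun r : 'rV[C]_1 => r 0 0 *: idm (e i)) => [f|r].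
  by rewrite mxE -scalar_coef.
by apply/rowP => l; rewrite mxE ipZr mulfK // !ord1.
Qed.

(** Dimensions of Hom(e_i, -) add up over direct sums. *)
Lemma object_of_seq (l : seq 'I_n) :
  exists z : H, forall i, has_dim (hom (e i) z) (count_mem i l).
Proof.
elim: l => [|k l [z zP]].
  have [z z0] := @tzero _ H; exists z => i /=; apply: has_dim0 => f.
  by rewrite -[f]comp1m z0 comp0l.
have [w [i1 [i2 [p1 [p2 [p1i1 p2i2 p2i1 p1i2 ipD]]]]]] := tsums (e k) z.
exists w => i /=.
apply: (@has_dim_add _ (hom (e i) (e k)) (hom (e i) z) (hom (e i) w) _ _
  (fun f => p1 \c f) (fun f => p2 \c f) (fun f => i1 \c f) (fun f => i2 \c f)
  (comp_linr p1) (comp_linr p2)).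
- by move=> f; rewrite compA p1i1 comp1m.
- by move=> f; rewrite compA p2i2 comp1m.
- by move=> f; rewrite compA p1i2 comp0l.
- by move=> f; rewrite compA p2i1 comp0l.
- by move=> f; rewrite !compA -compDl ipD comp1m.
- exact: has_dim_reps.
- exact: zP.
Qed.

Lemma object_of_dims (d : 'I_n -> nat) :
  exists z : H, forall i, has_dim (hom (e i) z) (d i).
Proof.
pose l := flatten [seq nseq (d j) j | j <- enum 'I_n].
have [z zP] := object_of_seq l.
exists z => i; suff <- : count_mem i l = d i by [].
rewrite count_flatten -map_comp sumnE big_map big_enum /= (bigD1 i) //=.
rewrite count_nseq /= eqxx mul1n big1 ?addn0 // => j ji.
by rewrite count_nseq /= (negPf ji).
Qed.

End Multiplicities.

Section RightAdjoint.
Local Open Scope ring_scope.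
Variables (C : numClosedFieldType) (H : twoHilb C) (K : hstarCat C).
Variables (n : nat) (e : 'I_n -> H).
Hypothesis eP : simple_reps e.
Variable F : lsfunctor H K.

(** The object r contains e_i with multiplicity dim Hom(F e_i, y); the counit
    sends an orthonormal basis of Hom(e_i, r) to one of Hom(F e_i, y). *)
Lemma unitary_counit (y : K) : exists (r : H) (c : hom (F r) y), forall i,
  (forall u v : hom (e i) r, ip (c \c fmap F u) (c \c fmap F v) = ip u v) /\
  (forall f : hom (F (e i)) y, exists u : hom (e i) r, c \c fmap F u = f).
Proof.
have [d dP] := choice (fun i => hilb_has_dim (hom (F (e i)) y)).
have [r rP] := object_of_dims eP d.
pose bas (V : hilb C) m (b : 'I_m -> V) :=
  orthonormal b /\ spans (fun _ => True) b.
pose f i := projT1 (cid (hilb_basis_of_dim (dP i))).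
have fP i : bas _ _ (f i) := projT2 (cid (hilb_basis_of_dim (dP i))).
pose j i := projT1 (cid (hilb_basis_of_dim (rP i))).
have jP i : bas _ _ (j i) := projT2 (cid (hilb_basis_of_dim (rP i))).
pose k i := ip (idm (e i)) (idm (e i)).
have k0 i : k i != 0.
  by rewrite gt_eqF // ip_id_gt0 //; case: (reps_scalar eP i).
(* The factor k i appears because the adjoint of j i a composed with u is the
   scalar ip (j i a) u / k i. *)
pose c := \sum_i k i *: \sum_a f i a \c fmap F (star (j i a)).
have cE i (u : hom (e i) r) : c \c fmap F u = \sum_a ip (j i a) u *: f i a.
  rewrite /c (linear_sumZ _ _ (comp_linl (fmap F u))) (bigD1 i) //=.
  have sumE i' : (\sum_a f i' a \c fmap F (star (j i' a))) \c fmap F u =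
      \sum_a f i' a \c fmap F (star (j i' a) \c u).
    have [l lE] := linear_bundled (comp_linl (z := y) (fmap F u)).
    rewrite -lE linear_sum; apply: eq_bigr => a _.
    by rewrite lE -compA -fmapM.
  rewrite [X in _ + X]big1 ?addr0 => [|i' ii']; last first.
    rewrite sumE big1 ?scaler0 // => a _.
    rewrite (reps_hom0 eP (star _ \c u)) ?fmap0 ?comp0r //.
    by apply/eqP; rewrite eq_sym.
  rewrite sumE scaler_sumr; apply: eq_bigr => a _.
  rewrite (scalar_coef (star (j i a) \c u) (reps_scalar eP i)) -ip_idl.
  by rewrite fmapZ fmap1 compZr compm1 scalerA mulrCA mulfV ?k0 // mulr1.
exists r, c => i; have [fo fs] := fP i; have [jo js] := jP i; split=> [u v|g].
  rewrite !cE ip_suml [v in RHS](js v) // ip_sumr; apply: eq_bigr => a _.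
  rewrite ipZl ipZr (orthonormal_coef (@ip_linr C _)) // -ip_herm.
  exact: mulrC.
exists (\sum_a ip (f i a) g *: j i a); rewrite cE [RHS](fs g) //.
by apply: eq_bigr => a _; rewrite (orthonormal_coef (@ip_linr C _)).
Qed.

Let robj y : H := projT1 (cid (unitary_counit y)).
Let counit y : hom (F (robj y)) y :=
  projT1 (cid (projT2 (cid (unitary_counit y)))).
Let counitP y : forall i,
  (forall u v : hom (e i) (robj y),
     ip (counit y \c fmap F u) (counit y \c fmap F v) = ip u v) /\
  (forall f : hom (F (e i)) y, exists u, counit y \c fmap F u = f) :=
  projT2 (cid (projT2 (cid (unitary_counit y)))).

Lemma hom_ext_simple x y (f g : hom x y) :
  (forall i (u : hom (e i) x), f \c u = g \c u) -> f = g.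
Proof.
move=> fg; rewrite -[f]compm1 -[g]compm1.
elim: (semisimple eP x) => [|w w' _ IH _ IH'|i q p].
- by rewrite !comp0r.
- by rewrite !compDr IH IH'.
- by rewrite !compA fg.
Qed.

Let counit_inj x y (u v : hom x (robj y)) :
  counit y \c fmap F u = counit y \c fmap F v -> u = v.
Proof.
move=> uv; apply: hom_ext_simple => i w; apply/eqP; rewrite -subr_eq0.
apply/eqP/ip_eq0; have [iso _] := counitP y i; rewrite -iso -compBl.
suff -> : counit y \c fmap F ((u - v) \c w) = 0 by rewrite ip0r.
rewrite fmapM -scaleN1r addrC fmap_lin compA compDr compZr uv.
by rewrite scaleN1r addNr comp0l.
Qed.

Let counit_surj x y (f : hom (F x) y) : exists u, counit y \c fmap F u = f.
Proof.
suff [u uf] : exists u, counit y \c fmap F u = f \c fmap F (idm x).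
  by exists u; rewrite uf fmap1 compm1.
elim: (semisimple eP x) => [|w w' _ [u uw] _ [u' uw']|i q p].
- by exists 0; rewrite !fmap0 !comp0r.
- by exists (u + u'); rewrite !fmapD !compDr uw uw'.
have [_ /(_ (f \c fmap F q))[u uq]] := counitP y i.
by exists (u \c p); rewrite !fmapM !compA uq.
Qed.

Let lift x y (f : hom (F x) y) : hom x (robj y) := projT1 (cid (counit_surj f)).
Let liftP x y (f : hom (F x) y) : counit y \c fmap F (lift f) = f :=
  projT2 (cid (counit_surj f)).

Let rmap y z (v : hom y z) : hom (robj y) (robj z) := lift (v \c counit y).

Let rmapP y z (v : hom y z) : counit z \c fmap F (rmap v) = v \c counit y.
Proof. exact: liftP. Qed.

Let rmap1 y : rmap (idm y) = idm (robj y).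
Proof. by apply: counit_inj; rewrite rmapP fmap1 compm1 comp1m. Qed.

Let rmapM x y z (g : hom y z) (f : hom x y) : rmap (g \c f) = rmap g \c rmap f.
Proof. by apply: counit_inj; rewrite rmapP fmapM compA rmapP -!compA rmapP. Qed.

Let R := Functor rmap1 rmapM.

Let unit_natural :
  @natural C H H (idF H) (compF0 R F) (fun x => lift (idm (F x))).
Proof.
move=> x y f; apply: counit_inj.
by rewrite /= !fmapM !compA liftP rmapP -compA liftP comp1m compm1.
Qed.

Let counit_natural : @natural C K K (compF0 F R) (idF K) counit.
Proof. by move=> x y f; rewrite /= rmapP. Qed.

Let tri1 x :
  NatTrans counit_natural (F x) \c fmap F (NatTrans unit_natural x) = idm (F x).
Proof. exact: liftP. Qed.

Let tri2 y :
  fmap R (NatTrans counit_natural y) \c NatTrans unit_natural (R y) = idm (R y).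
Proof.
apply: counit_inj; rewrite /= fmapM compA rmapP -compA liftP compm1.
by rewrite fmap1 compm1.
Qed.

(** The counits above are isometric on morphisms out of simples, and this
    is what turns the functor that they define into a *-functor. *)
Theorem star_right_adjoint : exists A : right_adjoint F, is_lin_star (radj A).
Proof.
exists (RightAdjoint tri1 tri2); split=> [x y a f g|x y f] /=.
  apply: counit_inj; rewrite rmapP fmap_lin compDr compZr !rmapP.
  by rewrite compDl compZl.
apply: hom_ext_simple => i u; apply: ip_inj => w.
have [isox _] := counitP x i; have [isoy _] := counitP y i.
rewrite -isox -ip_compl -isoy !fmapM !compA !rmapP.
by rewrite -!compA -ip_compl.
Qed.

End RightAdjoint.

(** * Even pairs *)

Section EvenPairs.
Local Open Scope ring_scope.
Variables (C : numClosedFieldType) (H K : hstarCat C) (F : lsfunctor H K).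

(** The first condition makes c universal. The second one says that u is the
    unit of the left adjoint structure given by the canonical even-handed
    structure; testing it on endomorphisms of r is enough to determine u. *)
Definition even_pair (y : K) (r : H) (c : hom (F r) y) (u : hom y (F r)) :=
  (forall x (f : hom (F x) y), exists v : hom x r, c \c fmap F v = f) /\
  (forall v : hom r r, ip (idm r) v = ip (u \c c) (fmap F v)).

Lemma even_pair_ip y r (c : hom (F r) y) (u : hom y (F r)) :
  even_pair c u -> forall x (v w : hom x r),
  ip v w = ip (c \c fmap F v) (star u \c fmap F w).
Proof.
move=> [_ cu] x v w; rewrite ip_idr cu ip_compl fmapM fmap_star.
by rewrite compA -ip_compr.
Qed.

(** The uniqueness half of universality comes for free: [even_pair_ip] computes
    the norm of v - w from c and F (v - w). *)
Lemma even_pair_inj y r (c : hom (F r) y) (u : hom y (F r)) :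
  even_pair c u -> forall x (v w : hom x r),
  c \c fmap F v = c \c fmap F w -> v = w.
Proof.
move=> cu x v w vw; apply/eqP; rewrite -subr_eq0; apply/eqP/ip_eq0.
rewrite (even_pair_ip cu) -scaleN1r addrC fmap_lin compDr compZr vw.
by rewrite scaleN1r addNr ip0l.
Qed.

(** The comparison of two representing objects carries one unit to the other
    because both are adjoint to the same pairing on Hom(F -, y). *)
Lemma even_pair_transport y r r' (c : hom (F r) y) (u : hom y (F r))
    (c' : hom (F r') y) (u' : hom y (F r')) (w : hom r r') :
  even_pair c u -> even_pair c' u' -> c' \c fmap F w = c ->
  u' = fmap F w \c u.
Proof.
move=> cu cu' cw; apply: (can_inj (@starK _ _ _ _)); apply: ip_inj => f.
have [v0 v0f] := cu.1 _ f; have [v vf] := cu'.1 _ f.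
have wv0 : w \c v0 = v.
  by apply: (even_pair_inj cu'); rewrite fmapM compA cw v0f.
transitivity (ip v (idm r')).
  by rewrite (even_pair_ip cu') vf fmap1 compm1.
rewrite starM -ip_compr -v0f -compA -fmapM.
rewrite -[star u]compm1 -fmap1 -(even_pair_ip cu) -wv0.
by rewrite ip_compl ip_compr compm1 comp1m.
Qed.

(** The second condition is the defining property of the even-handed structure,
    read on endomorphisms. *)
Lemma right_adjoint_even_pair (A : right_adjoint F) y :
  even_pair (rcounit A y) (psi_unit A y).
Proof.
split=> [x f|v]; first by exists (adj_phi A f); apply: adj_phiVK.
have := adj_psiP (A := A) (star v) (rcounit A y \c fmap F (idm (radj A y))).
rewrite (adj_phiK (idm (radj A y))) starK => ->.
rewrite fmap1 compm1 -[star v]compm1 adj_psi_natl starM fmap_star starK.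
by rewrite ip_compl.
Qed.

End EvenPairs.

Section TraceFormula.
Local Open Scope ring_scope.
Variables (C : numClosedFieldType) (gT : finGroupType).
Implicit Types a b : rep2 C gT.

(** The formula for the 2-character of s with an arbitrary pair (c, u) in place
    of the counit and of the even-handed unit. *)
Definition chi_at a b (s : mor1 a b) g (t : nat_trans (idF a) (act a g))
    (y : b) (r : a) (c : hom (s r) y) (u : hom y (s r)) : hom y (act b g y) :=
  fmap (act b g) c \c star (mnat s g r) \c fmap s (t r) \c u.

(** The comparison map between the two objects slides through the naturality
    squares of t and of the constraint of s, from the unit to the counit. *)
Lemma chi_at_indep a b (s : mor1 a b) g (t : nat_trans (idF a) (act a g))
    (y : b) (r r' : a) (c : hom (s r) y) (u : hom y (s r))
    (c' : hom (s r') y) (u' : hom y (s r')) :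
  even_pair c u -> even_pair c' u' -> chi_at t c u = chi_at t c' u'.
Proof.
move=> cu cu'; have [w cw] := cu'.1 _ c.
rewrite /chi_at (even_pair_transport cu cu' cw) -cw fmapM !compA.
congr (_ \c _); rewrite -!compA; congr (_ \c _).
rewrite -fmapM; have /= -> := ncompP t w; rewrite fmapM !compA.
by have /= -> := star_natural (mnat s g) w.
Qed.

Lemma chi_morE a b (s : mor1 a b) (A : right_adjoint s) g
    (t : chi_obj a g) (y : b) (r : a) (c : hom (s r) y) (u : hom y (s r)) :
  even_pair c u -> chi_mor A t y = chi_at t c u.
Proof. exact/chi_at_indep/right_adjoint_even_pair. Qed.

Lemma even_pair_id a (y : a) : even_pair (F := id1 a) (idm y) (idm y).
Proof.
by split=> [x f|v]; [exists f; rewrite comp1m | rewrite comp1m].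
Qed.

(** For the second condition, the equation for (k, u) is applied to the
    endomorphism of y obtained by compressing s w with v and l. *)
Lemma even_pair_comp a b c (t : mor1 b c) (s : mor1 a b) (z : c) (y : b)
    (x : a) (k : hom (t y) z) (u : hom z (t y)) (l : hom (s x) y)
    (v : hom y (s x)) :
  even_pair k u -> even_pair l v ->
  even_pair (F := comp1 t s) (k \c fmap t l) (fmap t v \c u).
Proof.
move=> ku lv; split=> [x' f|w].
  have [f' ff'] := ku.1 _ f; have [f'' ff''] := lv.1 _ f'.
  by exists f''; rewrite /= -compA -fmapM ff'' ff'.
rewrite lv.2 ip_compl ip_idr ku.2 /= -[X in _ = ip X _]compA.
rewrite [RHS]ip_compl [u \c (k \c _)]compA [RHS]ip_compr.
by rewrite !fmapM !fmap_star.
Qed.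

(** An isomorphism of 1-morphisms carries even pairs to even pairs even when it
    is not unitary, because the adjoint of a natural map is natural. *)
Lemma even_pair_iso a b (s r : mor1 a b) (t : nat_trans s r)
    (t' : nat_trans r s) (y : b) (x : a) (c : hom (s x) y) (u : hom y (s x)) :
  (forall x, t' x \c t x = idm (s x)) -> (forall x, t x \c t' x = idm (r x)) ->
  even_pair c u -> even_pair (F := r) (c \c t' x) (t x \c u).
Proof.
move=> tK t'K cu; split=> [x' f|w].
  have [v cv] := cu.1 _ (f \c t x'); exists v.
  have /= nt := ncompP t' v.
  by rewrite -compA nt compA cv -compA t'K compm1.
have /= nt := star_natural t w.
rewrite cu.2 -[X in _ = ip X _]compA.
rewrite [RHS]ip_compl [u \c (c \c _)]compA [RHS]ip_compr.
by rewrite nt -compA -starM tK star1 compm1.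
Qed.

(** The inverse t' enters only next to the counit, where being a 2-morphism and
    the unitarity of the constraints let it cancel against t. *)
Lemma chi_at_iso a b (s r : mor1 a b) (t : nat_trans s r)
    (t' : nat_trans r s) g (q : nat_trans (idF a) (act a g))
    (y : b) (x : a) (c : hom (s x) y) (u : hom y (s x)) :
  is_mor2 t -> (forall x, t' x \c t x = idm (s x)) ->
  chi_at (s := r) q (c \c t' x) (t x \c u) = chi_at q c u.
Proof.
move=> t2 tK; rewrite /chi_at fmapM !compA; congr (_ \c _).
have /= nt := ncompP t (q x); rewrite -[LHS]compA -nt !compA; congr (_ \c _).
rewrite -!compA; congr (_ \c _).
have [ss _] := mnat_unitary r g x; have [_ ss'] := mnat_unitary s g x.
rewrite -[t _]compm1 -ss' [t _ \c _]compA t2 -!compA.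
rewrite [star (mnat r g x) \c _]compA ss comp1m compA /= -fmapM tK fmap1.
by rewrite comp1m.
Qed.

End TraceFormula.

(** * The action of group elements on natural transformations *)

Section Translate.
Local Open Scope ring_scope.
Variables (C : numClosedFieldType) (gT : finGroupType).
Local Open Scope group_scope.

Lemma gcast_id (H : hstarCat C) (F : gT -> functor H H) g (e : g = g) x :
  gcast F e x = idm (F g x).
Proof. by rewrite (eq_irrelevance e erefl). Qed.

Lemma gcast_trans (H : hstarCat C) (F : gT -> functor H H) g1 g2 g3
    (e : g1 = g2) (e' : g2 = g3) (e'' : g1 = g3) x :
  gcast F e' x \c gcast F e x = gcast F e'' x.
Proof. by case: _ / e' e'' => e''; rewrite comp1m (eq_irrelevance e e''). Qed.

Lemma gcast_unitary (H : hstarCat C) (F : gT -> functor H H) g g' (e : g = g')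
  x : unitary_mor (gcast F e x).
Proof. by case: _ / e; split; rewrite /= star1 comp1m. Qed.

Section OneRep.
Variable a : rep2 C gT.
Implicit Types x : a.

Lemma amul_gcastl g2 g2' g1 (e : g2 = g2') (e' : g2 * g1 = g2' * g1) x :
  amul a g2' g1 x \c gcast (act a) e (act a g1 x)
  = gcast (act a) e' x \c amul a g2 g1 x.
Proof. by case: _ / e e' => e'; rewrite !gcast_id compm1 comp1m. Qed.

Lemma amul_gcastr g2 g1 g1' (e : g1 = g1') (e' : g2 * g1 = g2 * g1') x :
  amul a g2 g1' x \c fmap (act a g2) (gcast (act a) e x)
  = gcast (act a) e' x \c amul a g2 g1 x.
Proof. by case: _ / e e' => e'; rewrite !gcast_id /= fmap1 compm1 comp1m. Qed.

(** The unit constraint at an element that is only provably 1. *)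
Definition unit_at u (e : 1 = u) x : hom x (act a u x) :=
  gcast (act a) e x \c aunit a x.

Lemma unit_at_natural u (e : 1 = u) x y (f : hom x y) :
  unit_at e y \c f = fmap (act a u) f \c unit_at e x.
Proof.
case: _ / e; rewrite /unit_at /= !comp1m.
by have /= -> := ncompP (aunit a) f.
Qed.

Lemma unit_at_unitary u (e : 1 = u) x : unitary_mor (unit_at e x).
Proof. exact/unitary_comp/aunit_unitary/gcast_unitary. Qed.

Lemma amul_unit_atl u (e : 1 = u) g (e' : g = u * g) x :
  amul a u g x \c unit_at e (act a g x) = gcast (act a) e' x.
Proof.
case: _ / e e' => e'; rewrite /unit_at /= comp1m.
apply: (unitary_injl (gcast_unitary (act a) (mul1g g) x)).
by rewrite compA amul1g (gcast_trans _ _ _ erefl).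
Qed.

Lemma amul_unit_atr u (e : 1 = u) g (e' : g = g * u) x :
  amul a g u x \c fmap (act a g) (unit_at e x) = gcast (act a) e' x.
Proof.
case: _ / e e' => e'; rewrite /unit_at /= comp1m.
apply: (unitary_injl (gcast_unitary (act a) (mulg1 g) x)).
by rewrite compA amulg1 (gcast_trans _ _ _ erefl).
Qed.

Lemma act_ess_surj h x :
  exists u : hom x (act a h (act a h^-1 x)), unitary_mor u.
Proof.
exists (star (amul a h h^-1 x) \c unit_at (esym (mulgV h)) x).
apply: unitary_comp (unit_at_unitary _ _).
by case: (amul_unitary (r := a) h h^-1 x) => uu uu'; split; rewrite starK.
Qed.

Lemma act_bij g x y : bijective (@fmap _ _ _ (act a g) x y).
Proof. by case: (act_unitary (r := a) g x y). Qed.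

Lemma act_ip g x y (f f' : hom x y) :
  ip (fmap (act a g) f) (fmap (act a g) f') = ip f f'.
Proof. by case: (act_unitary (r := a) g x y). Qed.

Lemma nat_eq_on_act (F : lsfunctor a a) h (t t' : nat_trans (idF a) F) :
  (forall x, t (act a h x) = t' (act a h x)) -> t = t'.
Proof.
move=> tt'; apply: nat_trans_ext => x.
have [u uu] := act_ess_surj h x.
apply: (unitary_injl (unitary_fmap F uu)).
by have /= <- := ncompP t u; have /= <- := ncompP t' u; rewrite tt'.
Qed.

(** t' is the transform of t under h; reading this on the objects [act a h x]
    keeps inverses of group elements out of the coherence calculations. *)
Definition is_translate h g k (e : h * g = k * h) (t : chi_fib a g)
    (t' : chi_fib a k) : Prop :=
  forall x, amul a k h x \c t' (act a h x)
    = gcast (act a) e x \c amul a h g x \c fmap (act a h) (t x).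

Lemma translate_unique h g k (e e' : h * g = k * h) (t : chi_fib a g)
    (t1 t2 : chi_fib a k) :
  is_translate e t t1 -> is_translate e' t t2 -> t1 = t2.
Proof.
move=> tt1 tt2; apply: (@nat_eq_on_act _ h) => x.
apply: (unitary_injl (amul_unitary (r := a) k h x)).
by rewrite tt1 tt2 (eq_irrelevance e e').
Qed.

Lemma conj_mul (h g : gT) : h * g = h * g * h^-1 * h.
Proof. by rewrite mulgKV. Qed.

Lemma amul_assoc g3 g2 g1 x :
  amul a (g3 * g2) g1 x \c amul a g3 g2 (act a g1 x)
  = gcast (act a) (mulgA g3 g2 g1) x
      \c (amul a g3 (g2 * g1) x \c fmap (act a g3) (amul a g2 g1 x)).
Proof. by rewrite -amulA compA. Qed.

(** Associativity of the constraints for (hg, h^-1, h) and for (h, h^-1, h)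
    replaces the composite of the actions of h^-1 and h by the action of h^-1 h.
    Naturality of t moves the resulting unit constraint through t, and
    the unit laws then leave only casts. *)
Lemma chi_act_translate h g (t : chi_fib a g) :
  is_translate (conj_mul h g) t (chi_act h t).
Proof.
move=> x; have eu : 1 = h^-1 * h by rewrite mulVg.
pose m := amul a h^-1 h x; pose U := unit_at eu x.
pose tail := star (amul a h h^-1 (act a h x))
  \c unit_at (esym (mulgV h)) (act a h x).
have eh : h = h * (h^-1 * h) by rewrite mulVg mulg1.
have eh' : h = h * h^-1 * h by rewrite mulgKV.
have eg : h * g = h * g * (h^-1 * h) by rewrite mulVg mulg1.
have tailE : fmap (act a h) m \c tail = fmap (act a h) U.
  apply: (unitary_injl (amul_unitary (r := a) h _ x)).
  apply: (unitary_injl (gcast_unitary (act a) (mulgA h h^-1 h) x)).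
  rewrite (amul_unit_atr _ eh) (gcast_trans _ _ _ eh').
  rewrite !compA amulA /tail -!compA.
  rewrite (slide (proj2 (amul_unitary (r := a) h h^-1 _))) comp1m.
  exact: amul_unit_atl.
have /= tm := ncompP t m; have /= tU := ncompP t U.
have /= mm := ncompP (amul a h g) m; have /= mU := ncompP (amul a h g) U.
rewrite /= /chi_act_fun -!compA -/(unit_at _ _) -/tail.
rewrite (slide (amul_assoc (h * g) h^-1 h x)) -!compA -/m.
rewrite (slide (esym mm)) -!compA.
rewrite [fmap _ (fmap _ m) \c _]compA -fmapM -tm fmapM -!compA tailE.
rewrite -fmapM tU fmapM (slide mU) -!compA (slide (amul_unit_atr _ eg _)).
by rewrite (slide (gcast_trans _ _ _ (conj_mul h g) _)).
Qed.

Lemma translate_comp h1 h2 g k1 k2 (e1 : h1 * g = k1 * h1)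
    (e2 : h2 * k1 = k2 * h2) (e : h2 * h1 * g = k2 * (h2 * h1))
    (t : chi_fib a g) (t1 : chi_fib a k1) (t2 : chi_fib a k2) :
  is_translate e1 t t1 -> is_translate e2 t1 t2 -> is_translate e t t2.
Proof.
move=> tt1 tt2 x; apply: (unitary_injr (amul_unitary (r := a) h2 h1 x)).
apply: (unitary_injl (gcast_unitary (act a) (mulgA k2 h2 h1) x)).
have e3 : h2 * k1 * h1 = k2 * h2 * h1 by rewrite e2.
have e4 : h2 * (h1 * g) = h2 * (k1 * h1) by rewrite e1.
have e5 : h2 * (h1 * g) = k2 * h2 * h1 by rewrite mulgA e mulgA.
have e6 : h2 * h1 * g = k2 * h2 * h1 by rewrite -e5 mulgA.
have e7 : h2 * (k1 * h1) = k2 * h2 * h1 by rewrite -e5 e4.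
have /= nt := ncompP t2 (amul a h2 h1 x).
have /= nm := ncompP (amul a h2 h1) (t x).
have := tt1 x; have := tt2 (act a h1 x); rewrite -!compA => tt2' tt1'.
rewrite nt -nm [LHS]compA [LHS]compA amulA -!compA tt2'.
rewrite (slide (amul_gcastl e2 e3 _)) -!compA.
rewrite (slide (amul_assoc h2 k1 h1 x)) -!compA -fmapM tt1' !fmapM.
rewrite (slide (amul_gcastr e1 e4 _)) -!compA.
rewrite (slide (gcast_trans _ _ _ e7 _)) (slide (gcast_trans _ _ _ e5 _)).
rewrite (slide (amul_assoc h2 h1 g x)) -!compA.
by rewrite (slide (gcast_trans _ _ _ e6 _)) (slide (gcast_trans _ _ _ e5 _)).
Qed.

(** As with [unit_at], u is only provably 1, so as to cover u = h^-1 h. *)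
Lemma translate1_eq u (eu : 1 = u) g k (ek : g = k) (e : u * g = k * u)
    (t : chi_fib a g) (t' : chi_fib a k) :
  is_translate e t t' -> forall x, t' x = gcast (act a) ek x \c t x.
Proof.
move=> tt' x; have ek' : k = k * u by rewrite -eu mulg1.
have eg : g = u * g by rewrite -eu mul1g.
have egk : g = k * u by rewrite -ek'.
apply: (unitary_injl (gcast_unitary (act a) ek' x)).
have /= nt := ncompP t' (unit_at eu x).
have := congr1 (fun f => f \c unit_at eu x) (tt' x).
rewrite /= -!compA nt -(unit_at_natural eu (t x)).
rewrite (slide (amul_unit_atr eu ek' x)) => ->.
rewrite (slide (amul_unit_atl eu eg x)) (slide (gcast_trans _ _ _ egk _)).
by rewrite (slide (gcast_trans _ _ _ egk _)).
Qed.

Lemma ecast_chi k k' (e : k = k') (t : chi_fib a k) x :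
  ecast i (chi_fib a i) e t x = gcast (act a) e x \c t x.
Proof. by case: _ / e; rewrite gcast_id comp1m. Qed.

Lemma translate_cast h g k k' (ek : k = k') (e : h * g = k * h)
    (e' : h * g = k' * h) (t : chi_fib a g) (t' : chi_fib a k) :
  is_translate e t t' -> is_translate e' t (ecast i (chi_fib a i) ek t').
Proof. by case: _ / ek e' => e'; rewrite (eq_irrelevance e' e). Qed.

Lemma chi_actM h2 h1 g (t : chi_fib a g) :
  ecast k (chi_fib a k) (conj_conj h2 h1 g) (chi_act h2 (chi_act h1 t))
  = chi_act (h2 * h1) t.
Proof.
have e : h2 * h1 * g = h2 * (h1 * g * h1^-1) * h2^-1 * (h2 * h1).
  by rewrite !mulgA !mulgKV.
have tt := translate_comp e (chi_act_translate h1 t)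
  (chi_act_translate h2 (chi_act h1 t)).
exact: translate_unique (translate_cast _ (conj_mul _ _) tt)
  (chi_act_translate (h2 * h1) t).
Qed.

Lemma chi_act1_eq u (eu : 1 = u) g (t : chi_fib a g) (e : u * g * u^-1 = g) :
  ecast k (chi_fib a k) e (chi_act u t) = t.
Proof.
apply: nat_trans_ext => x; rewrite ecast_chi.
rewrite (translate1_eq eu (esym e) (chi_act_translate u t)).
by rewrite compA (gcast_trans _ _ _ erefl) comp1m.
Qed.

Lemma chi_act_linear h g : linear (@chi_act C gT a h g).
Proof.
move=> c t t'; apply: nat_trans_ext => x; rewrite /= /chi_act_fun /=.
by rewrite fmap_lin compDr compZr !compDl !compZl.
Qed.

End OneRep.

End Translate.

(** * The bundle of a 2-representation *)

Section Bundle.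
Local Open Scope ring_scope.
Variables (C : numClosedFieldType) (gT : finGroupType) (a : rep2 C gT).
Local Notation e := (@simples C a).
Let eP : simple_reps e := simplesP a.

Lemma act_scalar_end h (x : a) : scalar_end x -> scalar_end (act a h x).
Proof.
case=> x0 xS; split=> [|f].
  rewrite -(fmap1 (act a h)) -(fmap0 (act a h)) => /(bij_inj (act_bij h x x)).
  exact: x0.
have [g _ /(_ f) <-] := act_bij h x x; have [c ->] := xS (g f).
by exists c; rewrite fmapZ fmap1.
Qed.

Lemma act_iso_inj h (x y : a) : iso_obj (act a h x) (act a h y) -> iso_obj x y.
Proof.
case=> f [g [gf fg]]; have [f' _ f'K] := act_bij h x y.
have [g' _ g'K] := act_bij h y x; exists (f' f), (g' g); split.
  by apply: (bij_inj (act_bij h x x)); rewrite fmapM f'K g'K fmap1.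
by apply: (bij_inj (act_bij h y y)); rewrite fmapM f'K g'K fmap1.
Qed.

(** Acting by h is an equivalence, so it preserves simplicity and is injective
    on isomorphism classes. *)
Lemma act_perm_simples h : exists2 p : 'I_(nsimple a) -> 'I_(nsimple a),
  injective p &
  forall i, exists u : hom (act a h (e i)) (e (p i)), unitary_mor u.
Proof.
have eS i : scalar_end (act a h (e i)) by apply/act_scalar_end/reps_scalar.
case: eP => _ e_inj e_surj.
have [p pP] := choice (fun i => e_surj _ (scalar_end_simple (eS i))).
exists p => [i j pij|i]; last exact: iso_unitary.
apply/e_inj/(@act_iso_inj h)/(iso_obj_trans (pP i)); rewrite pij.
exact: iso_obj_sym.
Qed.

(** The sum over the simples e_i is first rewritten over the objects h e_i. *)
Lemma chi_act_ip h g (t t' : chi_fib a g) :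
  ip (chi_act h t) (chi_act h t') = ip t t'.
Proof.
have [p p_inj pP] := act_perm_simples h.
rewrite /= /chi_ip (reindex_inj p_inj); apply: eq_bigr => i _.
have [u uu] := pP i; rewrite (ip_id_unitary uu) (ip_nat_unitary _ _ uu).
rewrite -(fmap1 (act a h)) act_ip; congr (_ * _).
rewrite -(ip_unitaryl _ _ (amul_unitary (r := a) _ h (e i))).
rewrite !chi_act_translate -!compA ip_unitaryl ?ip_unitaryl ?act_ip //.
  exact: amul_unitary.
exact: gcast_unitary.
Qed.

Lemma nat_simples_inj g (t t' : chi_fib a g) :
  (forall i, t (e i) = t' (e i)) -> t = t'.
Proof.
move=> tt'; apply: nat_trans_ext => x; apply: (hom_ext_simple eP) => i u.
by have /= -> := ncompP t u; have /= -> := ncompP t' u; rewrite tt'.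
Qed.

(** A natural transformation is determined by its coordinates at the simples. *)
Lemma chi_fib_embeds g : exists n (f : chi_fib a g -> 'rV[C]_n),
  linear f /\ injective f.
Proof.
have [d dP] := choice (fun i => hilb_has_dim (hom (e i) (act a g (e i)))).
pose f i := projT1 (cid (dP i)).
have f_inj i : injective (f i) := bij_inj (projT2 (cid (dP i))).
pose I : finType := {i : 'I_(nsimple a) & 'I_(d i)}.
pose F (t : chi_fib a g) : 'rV[C]_#|I| := \row_(k < #|I|)
  f (tag (enum_val k)) (t (e (tag (enum_val k)))) 0 (tagged (enum_val k)).
exists #|I|, F; split=> [c t t'|t t' tt'].
  by apply/rowP => k; rewrite !mxE linearP !mxE.
apply: nat_simples_inj => i; apply: f_inj; apply/rowP => j.
have /rowP/(_ (enum_rank (Tagged (fun i => 'I_(d i)) j))) := tt'.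
by rewrite !mxE enum_rankK.
Qed.

Lemma chi_fib_hilb g : is_hilb (chi_fib a g).
Proof.
pose k i := ip (idm (e i)) (idm (e i)).
have k_gt0 i : 0 < k i by apply: ip_id_gt0; case: (reps_scalar eP i).
have lin (u : chi_fib a g) : scalar (ip u).
  move=> c v w; rewrite /= /chi_ip mulr_sumr -big_split.
  apply: eq_bigr => i _ /=.
  by rewrite ip_linr mulrDr mulrCA.
have herm (u v : chi_fib a g) : ip v u = (ip u v)^*.
  rewrite /= /chi_ip rmorph_sum; apply: eq_bigr => i _ /=.
  by rewrite rmorphM /= -!ip_herm.
have ge0 i (v : chi_fib a g) : 0 <= k i * ip (v (e i)) (v (e i)).
  apply: mulr_ge0; first exact: ltW.
  by case: (eqVneq (v (e i)) 0) => [->|/ip_gt0/ltW //]; rewrite ip0r.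
have pos (v : chi_fib a g) : v != 0 -> 0 < ip v v.
  move=> v0; rewrite lt_def sumr_ge0 ?andbT => [|i _]; last exact: ge0.
  apply: contraNneq v0 => /psumr_eq0P v_eq0; apply/eqP/nat_simples_inj => i.
  apply: ip_eq0; have := v_eq0 (fun i _ => ge0 i v) i isT.
  by move/eqP; rewrite mulf_eq0 gt_eqF ?k_gt0 //= => /eqP.
have [n [f [fl fi]]] := chi_fib_embeds g.
by split=> //; apply: (has_dim_embedded fl fi).
Qed.

Lemma chi_bundle : is_bundle (chi_obj a).
Proof.
split=> [|h g|h2 h1 g v|g v]; [exact: chi_fib_hilb | | exact: chi_actM |
  exact: chi_act1_eq].
have lin : linear (@chi_act C gT a h g) by apply: chi_act_linear.
have ip_act := @chi_act_ip h g.
split; [exact: lin | exact: ip_act | ].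
have act_inj h' g' : injective (@chi_act C gT a h' g').
  move=> t t' tt'; apply: (@ip_inj C (Hilb (chi_fib_hilb g'))) => w.
  by change (ip w t = ip w t'); rewrite -(chi_act_ip h') tt' chi_act_ip.
have e1 : (1 = h^-1 * h)%g by rewrite mulVg.
have e2 k : (h^-1 * (h * k * h^-1) * h^-1^-1 = k)%g.
  by rewrite invgK mulgA mulgKV mulKg.
have actK k (t : chi_fib a k) :
    ecast i (chi_fib a i) (e2 k) (chi_act h^-1%g (chi_act h t)) = t.
  have e : (h^-1 * h * k * (h^-1 * h)^-1 = k)%g.
    by rewrite mulVg mul1g invg1 mulg1.
  rewrite -[RHS](chi_act1_eq e1 t e) -chi_actM.
  by case: _ / (conj_conj _ _ _) e => e; rewrite (eq_irrelevance (e2 k) e).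
(* The action of h^-1 is a left inverse by the bundle laws. It is a right
   inverse too, since it is injective, as an isometry. *)
exists (fun t => ecast i (chi_fib a i) (e2 g) (chi_act h^-1%g t)).
  exact: actK.
move=> t; apply: (act_inj h^-1%g).
have ecast_inj k k' (ek : k = k') :
      injective (fun t => ecast i (chi_fib a i) ek t).
  by case: _ / ek.
exact: (ecast_inj _ _ (e2 g)) (actK _ _).
Qed.

End Bundle.

(** * The morphism of bundles of a 1-morphism *)

Section Equivariance.
Local Open Scope ring_scope.
Variables (C : numClosedFieldType) (gT : finGroupType).
Variables (a b : rep2 C gT) (s : mor1 a b).
Local Open Scope group_scope.

(** The coherence law of s for products, solved for the adjoints of
    the constraints, in which form it enters the 2-character. *)
Lemma mnatM_star g2 g1 (x : a) :
  star (mnat s (g2 * g1) x) \c fmap s (amul a g2 g1 x)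
  = amul b g2 g1 (s x) \c (fmap (act b g2) (star (mnat s g1 x))
      \c star (mnat s g2 (act a g1 x))).
Proof.
apply: (unitary_injl (mnat_unitary s (g2 * g1) x)).
rewrite !compA (proj2 (mnat_unitary s (g2 * g1) x)) comp1m mnatM.
rewrite -!compA /= [fmap _ _ \c (fmap _ _ \c _)]compA -fmapM.
rewrite (proj2 (mnat_unitary s g1 x)) fmap1 comp1m.
by rewrite (proj2 (mnat_unitary s g2 _)) compm1.
Qed.

Lemma mnat_star_gcast g g' (e : g = g') (x : a) :
  star (mnat s g' x) \c fmap s (gcast (act a) e x)
  = gcast (act b) e (s x) \c star (mnat s g x).
Proof. by case: _ / e; rewrite /= fmap1 compm1 comp1m. Qed.

(** Universality is transported by the equivalence, whose fullness also reduces
    the second condition to endomorphisms in the image of h; there unitarity of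
    the action and of the constraint of s removes h from the equation. *)
Lemma even_pair_act h (z : b) (r : a) (c : hom (s r) z) (u : hom z (s r)) :
  even_pair c u ->
  even_pair (F := s) (fmap (act b h) c \c star (mnat s h r))
                     (mnat s h r \c fmap (act b h) u).
Proof.
move=> cu; have star_unitary x := proj2 (mnat_unitary s h x).
split=> [x f|v].
  have [W [WW _]] := act_ess_surj h x; set x0 := act a h^-1 x in W WW.
  have [f0' _ f0K] := act_bij h (s x0) z.
  have [v0 v0E] := cu.1 _ (f0' (f \c fmap s (star W) \c mnat s h x0)).
  have /= nt := star_natural (mnat s h) v0.
  exists (fmap (act a h) v0 \c W).
  rewrite fmapM -!compA (slide nt) -!compA [fmap _ c \c _]compA -fmapM v0E f0K.
  rewrite -!compA (slide (star_unitary x0)) comp1m -fmapM WW fmap1.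
  by rewrite compm1.
have [v0 _ /(_ v) <-] := act_bij h r r; set w := v0 v.
have mu : unitary_mor (star (mnat s h r)).
  by case: (mnat_unitary s h r) => m1 m2; split; rewrite starK.
have /= nt := ncompP (mnat s h) w.
have -> : fmap s (fmap (act a h) w)
    = mnat s h r \c (fmap (act b h) (fmap s w) \c star (mnat s h r)).
  by rewrite compA nt -compA star_unitary compm1.
rewrite -compA ip_unitaryl; last exact: mnat_unitary.
rewrite compA ip_unitaryr // -fmapM act_ip -cu.2 -(fmap1 (act a h)).
by rewrite act_ip.
Qed.

(** At h z the 2-character is computed with the even pair carried over from z.
    The defining equation of translates, applied to t at the representing
    object, then becomes that equation for the 2-characters at z. *)
Lemma chi_mor_translate (A : right_adjoint s) h g k (e : h * g = k * h)
    (t : chi_fib a g) (t' : chi_fib a k) :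
  is_translate e t t' -> is_translate e (chi_mor A t) (chi_mor A t').
Proof.
move=> tt' z; have cu := right_adjoint_even_pair A z.
rewrite (chi_morE _ _ (even_pair_act h cu)) (chi_morE _ _ cu) /chi_at.
move: (rcounit A z) (psi_unit A z) cu => /=; set r := radj A z => c u cu.
have /= n1 := ncompP (amul b k h) c; have /= n2 := ncompP (amul b h g) c.
have /= n3 := gcast_natural (act b) e c.
have /= n4 := star_natural (mnat s h) (t r).
have t'E := congr1 (@fmap _ _ _ s _ _) (tt' r); rewrite !fmapM in t'E.
rewrite -!compA in t'E.
rewrite !fmapM -!compA (slide n1) -!compA.
rewrite (slide3 (esym (mnatM_star k h r))) -!compA.
rewrite [fmap s (amul a k h r) \c _]compA t'E -!compA.
rewrite (slide (mnat_star_gcast e r)) -!compA (slide (esym n3)) -!compA.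
rewrite (slide (mnatM_star h g r)) -!compA (slide n4) -!compA.
rewrite (slide (proj1 (mnat_unitary s h r))) comp1m.
by rewrite (slide (esym n2)) -!compA.
Qed.

Lemma chi_mor_linear (A : right_adjoint s) g :
  linear (@chi_mor C gT a b s A g).
Proof.
move=> c t t'; apply: nat_trans_ext => y; rewrite /= /chi_mor_fun /=.
by rewrite fmap_lin compDr compZr !compDl !compZl.
Qed.

End Equivariance.

Section Functoriality.
Local Open Scope ring_scope.
Variables (C : numClosedFieldType) (gT : finGroupType).
Implicit Types a b c : rep2 C gT.

Lemma mor1_right_adjoint a b (s : mor1 a b) :
  exists A : right_adjoint s, is_lin_star (radj A).
Proof. exact: star_right_adjoint (simplesP a) s. Qed.

Lemma chi_mor_indep a b (s : mor1 a b) (A A' : right_adjoint s) g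
  (t : chi_obj a g) : chi_mor A t = chi_mor A' t.
Proof.
apply: nat_trans_ext => y.
exact: chi_morE (right_adjoint_even_pair A' y).
Qed.

Lemma chi_mor_bundle_map a b (s : mor1 a b) (A : right_adjoint s) :
  @is_bundle_map C gT (chi_obj a) (chi_obj b) (@chi_mor C gT a b s A).
Proof.
split=> [g|h g t]; first exact: chi_mor_linear.
exact: translate_unique (chi_mor_translate A (chi_act_translate h t))
  (chi_act_translate h (chi_mor A t)).
Qed.

Lemma chi_mor_iso a b (s r : mor1 a b) (A : right_adjoint s)
    (B : right_adjoint r) : iso1 s r ->
  forall g (t : chi_obj a g), chi_mor A t = chi_mor B t.
Proof.
case=> u [u' [u2 _ uK u'K]] g t; apply: nat_trans_ext => y.
have su := right_adjoint_even_pair A y.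
rewrite (chi_morE B t (even_pair_iso uK u'K su)).
by rewrite (chi_at_iso _ _ _ u2 uK).
Qed.

Lemma chi_mor_id a (A : right_adjoint (id1 a)) g (t : chi_obj a g) :
  chi_mor A t = t.
Proof.
apply: nat_trans_ext => y; rewrite (chi_morE A t (even_pair_id y)) /chi_at /=.
by rewrite fmap1 star1 !comp1m compm1.
Qed.

Lemma chi_mor_comp a b c (s : mor1 a b) (r : mor1 b c) (A : right_adjoint s)
    (B : right_adjoint r) (D : right_adjoint (comp1 r s)) g (t : chi_obj a g) :
  chi_mor D t = chi_mor B (chi_mor A t).
Proof.
apply: nat_trans_ext => z; have ku := right_adjoint_even_pair B z.
have lv := right_adjoint_even_pair A (radj B z).
rewrite (chi_morE D t (even_pair_comp ku lv)) /= /chi_mor_fun /chi_at /=.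
rewrite /comp1_fun starM !fmapM -!compA; congr (_ \c _).
have /= nt := star_natural (mnat r g) (rcounit A (radj B z)).
by rewrite (slide (esym nt)) -!compA fmap_star.
Qed.

(** By invariance under isomorphism, the values of the functor can be computed
    from any representative and any right adjoint. *)
Theorem chi_functor (chiP : forall a : rep2 C gT, is_bundle (chi_obj a)) :
  let chi (a : rep2 C gT) : bundle C gT := Bundle (chiP a) in
  exists F1 : forall a b : ho2Rep C gT,
      cat_hom a b -> @cat_hom (HilbG C gT) (chi a) (chi b),
    @is_functor (ho2Rep C gT) (HilbG C gT) chi F1 /\
    (forall a b (s : mor1 a b) (A : right_adjoint s) g (t : chi_obj a g),
       (F1 a b (cls s) : bundle_map (chi a) (chi b)) g t = chi_mor A t).
Proof.
move=> chi.
pose adj a b (s : mor1 a b) := projT1 (cid (mor1_right_adjoint s)).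
pose F1 a b (q : isoclass a b) : bundle_map (chi a) (chi b) :=
  @BundleMap C gT (chi a) (chi b) _
    (chi_mor_bundle_map (adj a b (generic_quotient.repr q))).
have F1E a b (s : mor1 a b) (A : right_adjoint s) g (t : chi_obj a g) :
    F1 a b (cls s) g t = chi_mor A t.
  by apply: chi_mor_iso; apply/clsP; rewrite cls_repr.
exists F1; split=> //; split=> [a|a b c q p].
  by apply: bundle_map_ext => g t; rewrite (F1E _ _ _ (adj _ _ _)) chi_mor_id.
apply: bundle_map_ext => g t.
pose r := comp1 (generic_quotient.repr q) (generic_quotient.repr p).
exact: etrans (F1E _ _ r (adj _ _ r) g t) (chi_mor_comp _ _ _ t).
Qed.

End Functoriality.

Theorem theorem7p12 (R : realType) (gT : finGroupType) :
  exists chiP : forall a : rep2 R[i] gT, is_bundle (chi_obj a),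
  let chi (a : rep2 R[i] gT) : bundle R[i] gT := Bundle (chiP a) in
  (* every 1-morphism has a right adjoint, which may be taken to be
     a linear *-functor *)
  (forall (a b : rep2 R[i] gT) (s : mor1 a b),
     exists A : right_adjoint s, is_lin_star (radj A)) /\
  (* independence of the right adjoint *)
  (forall (a b : rep2 R[i] gT) (s : mor1 a b) (A A' : right_adjoint s),
     forall (g : gT) (t : chi_obj a g), chi_mor A t = chi_mor A' t) /\
  (* morphism of equivariant vector bundles *)
  (forall (a b : rep2 R[i] gT) (s : mor1 a b) (A : right_adjoint s),
     @is_bundle_map R[i] gT (chi a) (chi b) (@chi_mor R[i] gT a b s A)) /\
  (* invariance under isomorphism of 1-morphisms *)
  (forall (a b : rep2 R[i] gT) (s r : mor1 a b)
     (A : right_adjoint s) (B : right_adjoint r), iso1 s r ->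
     forall (g : gT) (t : chi_obj a g), chi_mor A t = chi_mor B t) /\
  (* identities and composition *)
  ((forall (a : rep2 R[i] gT) (A : right_adjoint (id1 a)),
      forall (g : gT) (t : chi_obj a g), chi_mor A t = t) /\
   (forall (a b c : rep2 R[i] gT) (s : mor1 a b) (r : mor1 b c)
      (A : right_adjoint s) (B : right_adjoint r)
      (D : right_adjoint (comp1 r s)),
      forall (g : gT) (t : chi_obj a g),
        chi_mor D t = chi_mor B (chi_mor A t))) /\
  (* chi descends to a functor from [2Rep(G)] to Hilb_G(G) *)
  exists F1 : forall a b : ho2Rep R[i] gT,
      cat_hom a b -> @cat_hom (HilbG R[i] gT) (chi a) (chi b),
    @is_functor (ho2Rep R[i] gT) (HilbG R[i] gT) chi F1 /\
    (forall (a b : rep2 R[i] gT) (s : mor1 a b) (A : right_adjoint s)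
       (g : gT) (t : chi_obj a g),
       (F1 a b (cls s) : bundle_map (chi a) (chi b)) g t = chi_mor A t).
Proof.
exists (@chi_bundle R[i]%C gT).
split; first exact: mor1_right_adjoint.
split; first exact: chi_mor_indep.
split; first exact: chi_mor_bundle_map.
split; first exact: chi_mor_iso.
split; last exact: chi_functor.
by split; [exact: chi_mor_id | exact: chi_mor_comp].
Qed.
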